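(* Let $C_{-1}:=\{f\in L^2(\mu): f\ge -1\}$. Then $$\{A\in\mathrm{Aff}_{\mathbb{R}}(L^2(\mu)):\ AC_{-1}=C_{-1}\}=\{(\sqrt{S'}-1,\,U_S):\ S\in\mathrm{Aut}_2(X,\mathcal{A},\mu)\}.$$
   Context: $(X,\mathcal{A},\mu)$ is a standard $\sigma$-finite non-atomic measure space. $\mathrm{Aut}(X,\mathcal A,\mu)$ is the group of invertible nonsingular transformations; for $S$ in it, $S':=\frac{d\mu\circ S^{-1}}{d\mu}$ and $U_S f:=\sqrt{S'}\,f\circ S^{-1}$ (a unitary on $L^2(\mu)$). $\mathrm{Aut}_2(X,\mathcal{A},\mu):=\{S\in\mathrm{Aut}(X,\mathcal A,\mu):\ \sqrt{S'}-1\in L^2(\mu)\}$. $\mathcal{U}_{\mathbb{R}}(L^2(\mu))$ denotes unitaries of $L^2(\mu)$ preserving the real subspace $L^2_{\mathbb{R}}(\mu)$, and $\mathrm{Aff}_{\mathbb{R}}(L^2(\mu)):=L^2_{\mathbb{R}}(\mu)\rtimes\mathcal{U}_{\mathbb{R}}(L^2(\mu))$, where $A=(f,V)$ acts by $Ah=f+Vh$ and $(f,V)(f',V')=(f+Vf',VV')$. *)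

(* Defs.v *)
From HB Require Import structures.
From mathcomp Require Import all_boot all_order all_algebra.
From mathcomp Require Import all_classical all_reals all_analysis.
From mathcomp Require Import complex.
Set Implicit Arguments. Unset Strict Implicit. Unset Printing Implicit Defensive.
Import Order.TTheory GRing.Theory Num.Theory.
Local Open Scope classical_set_scope.
Local Open Scope ring_scope.

(* Standard Borel space: Borel-isomorphic to a Borel subset of R
   (Kuratowski's characterisation of standard Borel spaces). *)
Definition standard_borel d (X : measurableType d) (R : realType) : Prop :=
  exists (phi : X -> R) (B : set R),
    measurable B /\ measurable_fun setT phi /\ injective phi /\
    range phi = B /\ (forall A : set X, measurable A -> measurable (phi @` A)).

Definition atom d (X : measurableType d) (R : realType)
    (mu : {measure set X -> \bar R}) (A : set X) : Prop :=
  measurable A /\ (0 < mu A)%E /\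
  forall B, measurable B -> B `<=` A -> mu B = 0%E \/ mu (A `\` B) = 0%E.

Definition nonatomic d (X : measurableType d) (R : realType)
    (mu : {measure set X -> \bar R}) : Prop := forall A, ~ atom mu A.

Definition L2 d (X : measurableType d) (R : realType)
    (mu : {measure set X -> \bar R}) (f : X -> R) : Prop :=
  f \in Lfun mu 2%:E.

Definition L2C d (X : measurableType d) (R : realType)
    (mu : {measure set X -> \bar R}) (f : X -> R[i]) : Prop :=
  L2 mu (fun x => complex.Re (f x)) /\ L2 mu (fun x => complex.Im (f x)).

Definition aeeq d (X : measurableType d) (R : realType)
    (mu : {measure set X -> \bar R}) (f g : X -> R[i]) : Prop :=
  {ae mu, forall x, f x = g x}.

Definition L2real d (X : measurableType d) (R : realType)
    (mu : {measure set X -> \bar R}) (f : X -> R[i]) : Prop :=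
  L2C mu f /\ {ae mu, forall x, complex.Im (f x) = 0}.

Definition normsq d (X : measurableType d) (R : realType)
    (mu : {measure set X -> \bar R}) (f : X -> R[i]) : \bar R :=
  (\int[mu]_x ((complex.Re (f x)) ^+ 2 + (complex.Im (f x)) ^+ 2)%:E)%E.

(* V (acting on representatives) defines a unitary operator of L^2(mu),
   i.e. a well-defined, C-linear, norm-preserving, surjective map,
   which moreover preserves the real subspace L^2_R(mu) *)
Definition unitary_R d (X : measurableType d) (R : realType)
    (mu : {measure set X -> \bar R}) (V : (X -> R[i]) -> (X -> R[i])) : Prop :=
  (forall f, L2C mu f -> L2C mu (V f)) /\
  (forall f g, L2C mu f -> L2C mu g -> aeeq mu f g -> aeeq mu (V f) (V g)) /\
  (forall (a : R[i]) f g, L2C mu f -> L2C mu g ->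
     aeeq mu (V (fun x => a * f x + g x)) (fun x => a * V f x + V g x)) /\
  (forall f, L2C mu f -> normsq mu (V f) = normsq mu f) /\
  (forall g, L2C mu g -> exists f, L2C mu f /\ aeeq mu (V f) g) /\
  (forall f, L2real mu f -> L2real mu (V f)).

(* (f, V) is an element of Aff_R(L^2(mu)) = L^2_R(mu) x| U_R(L^2(mu)) *)
Definition Aff_R d (X : measurableType d) (R : realType)
    (mu : {measure set X -> \bar R}) (f : X -> R[i])
    (V : (X -> R[i]) -> (X -> R[i])) : Prop :=
  L2real mu f /\ unitary_R mu V.

Definition aff_act (X : Type) (R : realType) (f : X -> R[i])
    (V : (X -> R[i]) -> (X -> R[i])) (h : X -> R[i]) : X -> R[i] :=
  fun x => f x + V h x.

Definition Cm1 d (X : measurableType d) (R : realType)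
    (mu : {measure set X -> \bar R}) (h : X -> R[i]) : Prop :=
  L2C mu h /\ {ae mu, forall x, complex.Im (h x) = 0 /\ -1 <= complex.Re (h x)}.

Definition preserves_Cm1 d (X : measurableType d) (R : realType)
    (mu : {measure set X -> \bar R}) (f : X -> R[i])
    (V : (X -> R[i]) -> (X -> R[i])) : Prop :=
  (forall h, Cm1 mu h -> Cm1 mu (aff_act f V h)) /\
  (forall g, Cm1 mu g -> exists h, Cm1 mu h /\ aeeq mu (aff_act f V h) g).

Definition nonsing_aut d (X : measurableType d) (R : realType)
    (mu : {measure set X -> \bar R}) (S Sinv : X -> X) : Prop :=
  [/\ measurable_fun setT S, measurable_fun setT Sinv,
      cancel S Sinv, cancel Sinv S &
      forall B, measurable B -> (mu B = 0%E <-> mu (S @^-1` B) = 0%E)].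

Definition RN_deriv_push d (X : measurableType d) (R : realType)
    (mu : {measure set X -> \bar R}) (S : X -> X) (h : X -> R) : Prop :=
  [/\ measurable_fun setT h, (forall x, 0 <= h x) &
      forall B, measurable B ->
        (\int[mu]_(x in B) (h x)%:E)%E = mu (S @^-1` B)].

Definition Aut2 d (X : measurableType d) (R : realType)
    (mu : {measure set X -> \bar R}) (S Sinv : X -> X) (h : X -> R) : Prop :=
  [/\ nonsing_aut mu S Sinv, RN_deriv_push mu S h &
      L2 mu (fun x => Num.sqrt (h x) - 1)].

Definition U_S (X : Type) (R : realType) (Sinv : X -> X) (h : X -> R)
    (g : X -> R[i]) : X -> R[i] :=
  fun x => ((Num.sqrt (h x))%:C)%C * g (Sinv x).

Definition sqrtS'm1 (X : Type) (R : realType) (h : X -> R) : X -> R[i] :=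
  fun x => ((Num.sqrt (h x) - 1)%:C)%C.

(* Main.v *)
(* Proof idea. If A = (f, V) preserves C_{-1}, then V preserves the recession
   cone of C_{-1}, that is the nonnegative functions, and so does its inverse.
   Hence V acts on real functions as a linear order isomorphism P, which
   therefore commutes with minima and with countable suprema.  Fix w > 0 in L2
   and an injection phi into R with w phi in L2.  As the indicator of
   {g > q w} is the supremum of the functions min (n (g - q w)^+ / w, 1), the
   operator P maps w 1_{g > q w} to (P w) 1_{P g > q (P w)}; taking g = w phi
   and closing under the set operations yields a point map T with
   P g = (P w) ((g / w) o T).  The map obtained from the inverse of P inverts T
   almost everywhere.  It is corrected into a bijection by conjugating with
   bijections of X onto conull sets that are the identity almost everywhere;
   these come from a Hilbert hotel inside a null set containing a Borel copy of
   an interval, which exists because mu is non-atomic.  Finally h = (P w / w o Sinv)^2 is the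
   density because P is isometric, and f = sqrt h - 1 follows by applying A and
   its inverse to the functions -1_F, with F of finite measure. *)
Require Import Defs.
From HB Require Import structures.
From mathcomp Require Import all_boot all_order all_algebra.
From mathcomp Require Import all_classical all_reals all_analysis.
From mathcomp Require Import complex.
From mathcomp Require Import measurable_realfun.
From mathcomp Require Import ring lra.
Import Order.TTheory GRing.Theory Num.Theory.
Import numFieldNormedType.Exports.
Local Open Scope classical_set_scope.
Local Open Scope ring_scope.

Set Implicit Arguments.
Unset Strict Implicit.
Unset Printing Implicit Defensive.

(** * The space L2 *)

(** The weight w stands in for the constant 1, which is not in L2 when mu is infinite; hence the
    quotients g / w. The main obstacle is the passage from almost everywhere to everywhere.
    Operators see functions only up to null sets, so they determine point maps only up to null sets,
    whereas [nonsing_aut] asks for maps that are inverse to each other at every point. The null sets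
    on which two almost inverse maps fail can have different cardinalities, so they cannot simply be
    matched with each other; each is absorbed into the rest of the space instead. This requires a
    null set with room for a code of every point of X together with all the halves of that code.
    Non-atomicity provides it: points are null, so the distribution function of a set of positive
    measure is continuous, and a strictly increasing function with null range can be pulled back
    through it. *)

Section L2_space.
Context (d : measure_display) (X : measurableType d) (R : realType)
  (mu : {measure set X -> \bar R}).
Implicit Types f g : X -> R.

Lemma L2P f : L2 mu f <->
  measurable_fun setT f /\ (\int[mu]_x ((f x) ^+ 2)%:E < +oo)%E.
Proof.
split=> [Lf|[mf foo]].
  split; first by move: (Lf); rewrite /L2 inE => /andP[/[!inE]].
  have /integrableP[_] := Lfun2_integrable_sqr Lf.
  by under eq_integral do rewrite gee0_abs ?lee_fin ?sqr_ge0//.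
rewrite /L2 inE; apply/andP; split; first by rewrite inE.
rewrite inE /finite_norm /= /finite_norm unlock /Lnorm poweR_lty//.
by under eq_integral => x _ do rewrite /= powR_mulrn// real_normK ?num_real//.
Qed.

Lemma L2_measurable f : L2 mu f -> measurable_fun setT f.
Proof. by case/L2P. Qed.

Lemma L2_lin a f g : L2 mu f -> L2 mu g -> L2 mu (fun x => a * f x + g x).
Proof.
have p1 : (1 <= 2%:E :> \bar R)%E by rewrite lee_fin ler1n.
by move=> Lf Lg; exact: ((@Lfun_submod_closed _ X R mu _ p1).2 a f g Lf Lg).
Qed.

Lemma L2_le_ae f g : measurable_fun setT g -> L2 mu f ->
  {ae mu, forall x, `|g x| <= `|f x|} -> L2 mu g.
Proof.
move=> mg /L2P[mf foo] gf; apply/L2P; split=> //.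
apply: le_lt_trans foo; apply: ae_ge0_le_integral => //.
- by move=> x _; rewrite lee_fin sqr_ge0.
- by apply/measurable_EFinP; exact: measurable_funX.
- by move=> x _; rewrite lee_fin sqr_ge0.
- by apply/measurable_EFinP; exact: measurable_funX.
apply: filterS gf => x gfx _; rewrite lee_fin.
by rewrite -(real_normK (num_real (g x))) -(real_normK (num_real (f x))) lerXn2r ?nnegrE.
Qed.

Lemma L2_le f g : measurable_fun setT g -> L2 mu f ->
  (forall x, `|g x| <= `|f x|) -> L2 mu g.
Proof. by move=> mg Lf gf; apply: L2_le_ae Lf _ => //; exact: aeW. Qed.

Lemma L2_0 : L2 mu (fun _ : X => 0).
Proof.
apply/L2P; split=> //.
by under eq_integral do rewrite expr0n; rewrite integral0.
Qed.

Lemma L2Z a f : L2 mu f -> L2 mu (fun x => a * f x).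
Proof.
move=> Lf; have := L2_lin a Lf L2_0.
by congr L2; apply/funext => x; rewrite addr0.
Qed.

Lemma L2D f g : L2 mu f -> L2 mu g -> L2 mu (fun x => f x + g x).
Proof.
move=> Lf Lg; have := L2_lin 1 Lf Lg.
by congr L2; apply/funext => x; rewrite mul1r.
Qed.

Lemma L2B f g : L2 mu f -> L2 mu g -> L2 mu (fun x => f x - g x).
Proof.
move=> Lf Lg; have := L2_lin (-1) Lg Lf.
by congr L2; apply/funext => x; rewrite mulN1r addrC.
Qed.

Lemma L2_abs f : L2 mu f -> L2 mu (fun x => `|f x|).
Proof.
move=> Lf; apply: L2_le (Lf) _ => [|x]; last by rewrite normr_id.
exact: measurableT_comp (L2_measurable Lf).
Qed.

Lemma L2_min f g : L2 mu f -> L2 mu g -> L2 mu (fun x => Num.min (f x) (g x)).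
Proof.
move=> Lf Lg; apply: L2_le (L2D (L2_abs Lf) (L2_abs Lg)) _ => [|x].
  by apply: measurable_minr; exact: L2_measurable.
rewrite (@ger0_norm _ (`|f x| + `|g x|)) ?addr_ge0//.
by rewrite /Num.min; case: ifP => _; rewrite ?lerDl ?lerDr.
Qed.

Lemma L2_max f g : L2 mu f -> L2 mu g -> L2 mu (fun x => Num.max (f x) (g x)).
Proof.
move=> Lf Lg; apply: L2_le (L2D (L2_abs Lf) (L2_abs Lg)) _ => [|x].
  by apply: measurable_maxr; exact: L2_measurable.
rewrite (@ger0_norm _ (`|f x| + `|g x|)) ?addr_ge0//.
by rewrite /Num.max; case: ifP => _; rewrite ?lerDl ?lerDr.
Qed.

Lemma L2_indic f (A : set X) : measurable A -> L2 mu f ->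
  L2 mu (fun x => f x * \1_A x).
Proof.
move=> mA Lf; apply: L2_le (Lf) _ => [|x].
  by apply: measurable_funM; [exact: L2_measurable|exact: measurable_indic].
by rewrite normrM ler_piMr// indicE; case: (_ \in _); rewrite ?normr1 ?normr0.
Qed.

Lemma L2_indic1 (A : set X) : measurable A -> (mu A < +oo)%E -> L2 mu (\1_A : X -> R).
Proof.
move=> mA Aoo; apply/L2P; split; first exact: measurable_indic.
have E x : (\1_A x ^+ 2 = \1_A x :> R).
  by rewrite indicE; case: (_ \in _); rewrite ?expr1n ?expr0n.
under eq_integral do rewrite E.
by rewrite integral_indic// setIT.
Qed.

Lemma ae_eq_L2 f g : measurable_fun setT g -> L2 mu f ->
  {ae mu, forall x, f x = g x} -> L2 mu g.
Proof.
by move=> mg Lf fg; apply: L2_le_ae Lf _ => //; apply: filterS fg => x ->.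
Qed.

Lemma L2_eq0 f : L2 mu f -> (\int[mu]_x ((f x) ^+ 2)%:E = 0)%E ->
  {ae mu, forall x, f x = 0}.
Proof.
move=> /L2P[mf _] f0.
have mf2 : measurable_fun setT (fun x : X => ((f x) ^+ 2)%:E).
  by apply/measurable_EFinP; exact: measurable_funX.
have : (\int[mu]_x `| ((f x) ^+ 2)%:E | = 0)%E.
  by under eq_integral do rewrite gee0_abs ?lee_fin ?sqr_ge0//.
move=> /(ae_eq_integral_abs mu measurableT mf2); apply: filterS => x /(_ Logic.I) [] /eqP.
by rewrite sqrf_eq0 => /eqP.
Qed.

End L2_space.

(** * Order isomorphisms of L2 *)

Lemma indicb (R : realType) (X : Type) (b : pred X) (x : X) :
  \1_[set x | b x] x = (b x)%:R :> R.
Proof.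
rewrite indicE; congr (_%:R); congr nat_of_bool.
by apply/idP/idP => [|bx]; [rewrite inE|apply/mem_set].
Qed.

Lemma indic_mem (R : realType) (X : Type) (A : set X) (x : X) : A x -> \1_A x = 1 :> R.
Proof. by move=> Ax; rewrite indicE mem_set. Qed.

Lemma indic_notin (R : realType) (X : Type) (A : set X) (x : X) : ~ A x -> \1_A x = 0 :> R.
Proof. by move=> Ax; rewrite indicE memNset. Qed.

Lemma indic_eqP (R : realType) (X Y : Type) (A : set X) (B : set Y) (x : X) (y : Y) :
  (\1_A x = \1_B y :> R) <-> (A x <-> B y).
Proof.
have n10 : 1 <> 0 :> R by apply/eqP; exact: oner_neq0.
have [Ax|Ax] := pselect (A x); have [By|By] := pselect (B y);
  rewrite ?(indic_mem _ Ax) ?(indic_mem _ By) ?(indic_notin _ Ax) ?(indic_notin _ By); split=> //.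
- by case=> /(_ Ax).
- by move/esym.
- by case=> _ /(_ By).
Qed.

Section order_isomorphism.
Context (d : measure_display) (X : measurableType d) (R : realType)
  (mu : {measure set X -> \bar R}).
Implicit Types (f g u w : X -> R) (P : (X -> R) -> (X -> R)).

(** Operators act on representatives, so each law holds only almost everywhere. The equivalence in
    [oi_le] also yields injectivity and compatibility with almost everywhere equality. *)
Record order_iso P : Prop := OrderIso {
  oi_L2 : forall f, L2 mu f -> L2 mu (P f) ;
  oi_lin : forall a f g, L2 mu f -> L2 mu g ->
    {ae mu, forall x, P (fun y => a * f y + g y) x = a * P f x + P g x} ;
  oi_le : forall f g, L2 mu f -> L2 mu g ->
    {ae mu, forall x, f x <= g x} <-> {ae mu, forall x, P f x <= P g x} ;
  oi_surj : forall g, L2 mu g ->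
    exists2 f, L2 mu f & {ae mu, forall x, P f x = g x} }.

Context (P : (X -> R) -> (X -> R)) (isoP : order_iso P).

Lemma oi_homo f g : L2 mu f -> L2 mu g ->
  {ae mu, forall x, f x <= g x} -> {ae mu, forall x, P f x <= P g x}.
Proof. by move=> Lf Lg; apply: (iffLR (oi_le isoP _ _)). Qed.

Lemma oi_reflect f g : L2 mu f -> L2 mu g ->
  {ae mu, forall x, P f x <= P g x} -> {ae mu, forall x, f x <= g x}.
Proof. by move=> Lf Lg; apply: (iffRL (oi_le isoP _ _)). Qed.

Lemma oi_eq f g : L2 mu f -> L2 mu g ->
  {ae mu, forall x, f x = g x} <-> {ae mu, forall x, P f x = P g x}.
Proof.
move=> Lf Lg.
have fg := oi_le isoP Lf Lg; have gf := oi_le isoP Lg Lf.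
split=> H.
  have /fg H1 : {ae mu, forall x, f x <= g x} by apply: filterS H => x ->.
  have /gf H2 : {ae mu, forall x, g x <= f x} by apply: filterS H => x ->.
  by apply: filterS2 H1 H2 => x h1 h2; apply/le_anti; rewrite h1.
have /fg H1 : {ae mu, forall x, P f x <= P g x} by apply: filterS H => x ->.
have /gf H2 : {ae mu, forall x, P g x <= P f x} by apply: filterS H => x ->.
by apply: filterS2 H1 H2 => x h1 h2; apply/le_anti; rewrite h1.
Qed.

Lemma oi_0 : {ae mu, forall x, P (fun=> 0) x = 0}.
Proof.
have L0 := L2_0 (R := R) mu.
have := oi_lin isoP (-1) L0 L0.
have -> : (fun _ : X => -1 * 0 + 0 : R) = fun=> 0.
  by apply/funext => x; rewrite mulr0 addr0.
by apply: filterS => x ->; rewrite mulN1r addNr.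
Qed.

Lemma oiZ a f : L2 mu f -> {ae mu, forall x, P (fun y => a * f y) x = a * P f x}.
Proof.
move=> Lf; have := oi_lin isoP a Lf (L2_0 mu).
have -> : (fun y => a * f y + 0) = fun y => a * f y.
  by apply/funext => x; rewrite addr0.
by apply: filterS2 oi_0 => x -> ->; rewrite addr0.
Qed.

Lemma oiB f g : L2 mu f -> L2 mu g ->
  {ae mu, forall x, P (fun y => f y - g y) x = P f x - P g x}.
Proof.
move=> Lf Lg; have := oi_lin isoP (-1) Lg Lf.
have -> : (fun y => -1 * g y + f y) = fun y => f y - g y.
  by apply/funext => x; rewrite mulN1r addrC.
by apply: filterS => x ->; rewrite mulN1r addrC.
Qed.

(** By surjectivity H is the image of some u. Order reflection turns P g_n <= P u into g_n <= u, so
    G <= u and P G <= H; the converse is monotonicity. The order alone thus provides the continuity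
    of P, and countability of the family keeps the exceptional set null. *)
Lemma oi_sup (g_ : nat -> X -> R) G H :
  (forall n, L2 mu (g_ n)) -> L2 mu G -> L2 mu H ->
  (forall x n, g_ n x <= G x) ->
  (forall x y, (forall n, g_ n x <= y) -> G x <= y) ->
  {ae mu, forall x, forall n, P (g_ n) x <= H x} ->
  {ae mu, forall x, forall y, (forall n, P (g_ n) x <= y) -> H x <= y} ->
  {ae mu, forall x, P G x = H x}.
Proof.
move=> Lg LG LH gG lubG gH lubH.
have [u Lu Pu] := oi_surj isoP LH.
have Gu : {ae mu, forall x, G x <= u x}.
  have : forall n, {ae mu, forall x, g_ n x <= u x}.
    by move=> n; apply: oi_reflect => //; apply: filterS2 Pu gH => x ->.
  by move/ae_foralln; apply: filterS => x; exact: lubG.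
have PGn : {ae mu, forall x, forall n, P (g_ n) x <= P G x}.
  by apply: ae_foralln => n; apply: oi_homo => //; exact: aeW.
move/(oi_le isoP LG Lu): Gu => PG.
apply: filterS3 PG Pu (filterI PGn lubH) => x h1 h2 [h3 h4].
by apply/le_anti; rewrite -{1}h2 h1 h4.
Qed.

Lemma oi_min f g : L2 mu f -> L2 mu g ->
  {ae mu, forall x, P (fun y => Num.min (f y) (g y)) x = Num.min (P f x) (P g x)}.
Proof.
move=> Lf Lg; have Lm := L2_min Lf Lg.
have LPm := L2_min (oi_L2 isoP Lf) (oi_L2 isoP Lg).
have [u Lu Pu] := oi_surj isoP LPm.
have uf : {ae mu, forall x, u x <= f x}.
  by apply: oi_reflect => //; apply: filterS Pu => x ->; rewrite ge_min lexx.
have ug : {ae mu, forall x, u x <= g x}.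
  by apply: oi_reflect => //; apply: filterS Pu => x ->; rewrite ge_min lexx orbT.
have um : {ae mu, forall x, u x <= Num.min (f x) (g x)}.
  by apply: filterS2 uf ug => x h1 h2; rewrite le_min h1.
move/(oi_le isoP Lu Lm): um => um.
have mf : {ae mu, forall x, P (fun y => Num.min (f y) (g y)) x <= P f x}.
  by apply: oi_homo => //; apply: aeW => x; rewrite ge_min lexx.
have mg : {ae mu, forall x, P (fun y => Num.min (f y) (g y)) x <= P g x}.
  by apply: oi_homo => //; apply: aeW => x; rewrite ge_min lexx orbT.
apply: filterS3 um Pu (filterI mf mg) => x h1 h2 [h3 h4].
by apply/le_anti; rewrite le_min h3 h4 -h2 h1.
Qed.

Lemma oi_pos_part f : L2 mu f ->
  {ae mu, forall x, P (fun y => Num.max (f y) 0) x = Num.max (P f x) 0}.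
Proof.
move=> Lf; have Lm := L2_min Lf (L2_0 mu).
have E : (fun y => Num.max (f y) 0) = (fun y => f y - Num.min (f y) 0).
  by apply/funext => y; rewrite maxC; case: leP; rewrite ?subrr ?subr0.
have := oiB Lf Lm; rewrite E.
apply: filterS3 (oi_min Lf (L2_0 mu)) oi_0 => x h1 h2 ->.
by rewrite h1 h2 maxC; case: leP; rewrite ?subrr ?subr0.
Qed.

Lemma oi_ge0 f : L2 mu f -> {ae mu, forall x, 0 <= f x} ->
  {ae mu, forall x, 0 <= P f x}.
Proof.
move=> Lf /(oi_le isoP (L2_0 mu) Lf).
by apply: filterS2 oi_0 => x ->.
Qed.

Section weight.
Context (w : X -> R) (Lw : L2 mu w) (w_gt0 : forall x, 0 < w x).

(** If P w vanishes on E, the preimage u of w 1_E satisfies min (P u, P w) = 0, hence min (u, w) =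
    0. As w > 0 this forces u = 0, so w 1_E = 0 and E is null. *)
Lemma oi_gt0 : {ae mu, forall x, 0 < P w x}.
Proof.
have Pw0 : {ae mu, forall x, 0 <= P w x}.
  by apply: oi_ge0 => //; apply: aeW => x; exact/ltW.
pose E := [set x | P w x <= 0].
have mE : measurable E.
  rewrite -[E]setTI; apply: measurable_fun_ler => //.
  exact: L2_measurable (oi_L2 isoP Lw).
have LwE := L2_indic mE Lw.
have [u Lu Pu] := oi_surj isoP LwE.
have u_ge0 : {ae mu, forall x, 0 <= u x}.
  apply: oi_reflect => //; first exact: L2_0.
  apply: filterS2 Pu oi_0 => x -> ->.
  by rewrite mulr_ge0 ?indicE// ltW.
have m0 : {ae mu, forall x, Num.min (u x) (w x) = 0}.
  apply/(oi_eq (L2_min Lu Lw) (L2_0 mu)).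
  apply: filterS3 (oi_min Lu Lw) (filterI Pu Pw0) oi_0 => x -> [-> h] ->.
  have [Ex|nEx] := pselect (E x).
    have -> : P w x = 0 by apply/le_anti; rewrite h andbT.
    by rewrite min_r// mulr_ge0 ?indicE// ltW.
  by rewrite indic_notin// mulr0 min_l.
have u0 : {ae mu, forall x, u x = 0}.
  apply: filterS2 m0 u_ge0 => x; case: (leP (u x)) => // _ w0.
  by have := w_gt0 x; rewrite w0 ltxx.
move/(oi_eq Lu (L2_0 mu)): u0 => Pu0.
apply: filterS3 Pu0 Pu oi_0 => x h1 h2 h3; rewrite ltNge; apply/negP => Ex.
have : w x = 0 by rewrite -h3 -h1 h2 indic_mem ?mulr1.
by have := w_gt0 x => /[swap] ->; rewrite ltxx.
Qed.

(** The trace of P on sets, with w in the role of 1. Once P is known to be a weighted composition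
    with T, the set B is T^-1 A up to a null set. *)
Definition corresponds (A B : set X) :=
  {ae mu, forall x, P (fun y => w y * \1_A y) x = P w x * \1_B x}.

Lemma corresponds_ae A B B' : corresponds A B ->
  {ae mu, forall x, B x <-> B' x} -> corresponds A B'.
Proof.
rewrite /corresponds => AB BB'; apply: filterS2 AB BB' => x -> h; congr (_ * _).
exact/indic_eqP.
Qed.

Lemma corresponds_uniq A B B' : corresponds A B -> corresponds A B' ->
  {ae mu, forall x, B x <-> B' x}.
Proof.
rewrite /corresponds => AB AB'; apply: filterS3 AB AB' oi_gt0 => x -> h Pw.
apply/(@indic_eqP R); apply: (@mulfI _ (P w x)) => //; exact: lt0r_neq0.
Qed.

Lemma correspondsC A B : measurable A -> corresponds A B -> corresponds (~` A) (~` B).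
Proof.
move=> mA AB; have LwA := L2_indic mA Lw.
have E : (fun y => w y * \1_(~` A) y) = (fun y => w y - w y * \1_A y).
  apply/funext => y; have [Ay|Ay] := pselect (A y).
    by rewrite (indic_mem _ Ay) indic_notin ?mulr1 ?mulr0 ?subrr//; exact.
  by rewrite (indic_notin _ Ay) indic_mem ?mulr1 ?mulr0 ?subr0.
rewrite /corresponds E; apply: filterS2 (oiB Lw LwA) AB => x -> ->.
have [By|By] := pselect (B x).
  by rewrite (indic_mem _ By) indic_notin ?mulr1 ?mulr0 ?subrr//; exact.
by rewrite (indic_notin _ By) indic_mem ?mulr1 ?mulr0 ?subr0.
Qed.

Lemma correspondsT : corresponds setT setT.
Proof.
have E : (fun y => w y * \1_setT y) = w by apply/funext => y; rewrite indic_mem ?mulr1.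
by rewrite /corresponds E; apply: aeW => x; rewrite indic_mem ?mulr1.
Qed.

Lemma corresponds_bigcup (A B : nat -> set X) :
  (forall n, measurable (A n)) -> (forall n, measurable (B n)) ->
  (forall n, corresponds (A n) (B n)) ->
  corresponds (\bigcup_n A n) (\bigcup_n B n).
Proof.
move=> mA mB AB.
have LwA n := L2_indic (mA n) Lw.
have LPw := oi_L2 isoP Lw.
have lub f x y (C : nat -> set X) : 0 <= f x -> (forall n, f x * \1_(C n) x <= y) ->
    f x * \1_(\bigcup_n C n) x <= y.
  move=> fx h; have [[n _ Cn]|nC] := pselect ((\bigcup_n C n) x).
    by rewrite indic_mem; [have := h n; rewrite indic_mem|exists n].
  rewrite (indic_notin _ nC) mulr0; apply: le_trans (h 0%N).
  by rewrite mulr_ge0// indicE.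
have ub f x (C : nat -> set X) n : 0 <= f x ->
    f x * \1_(C n) x <= f x * \1_(\bigcup_n C n) x.
  move=> fx; rewrite ler_wpM2l//.
  have [Cn|Cn] := pselect (C n x); last by rewrite (indic_notin _ Cn) indicE.
  by rewrite (indic_mem _ Cn) indic_mem//; exists n.
rewrite /corresponds; apply: (@oi_sup (fun n y => w y * \1_(A n) y)) => //.
- by apply: L2_indic => //; exact: bigcup_measurable.
- by apply: L2_indic => //; exact: bigcup_measurable.
- by move=> x n; apply: ub; exact/ltW.
- by move=> x y; apply: lub; exact/ltW.
- apply: filterS2 (ae_foralln AB) oi_gt0 => x h Pw n.
  by rewrite h; apply: ub; exact/ltW.
- apply: filterS2 (ae_foralln AB) oi_gt0 => x h Pw y h1.
  by apply: lub => [|n]; [exact/ltW|rewrite -h].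
Qed.

Lemma corresponds_pos u : L2 mu u ->
  corresponds [set x | 0 < u x] [set x | 0 < P u x].
Proof.
move=> Lu; have mpos f : L2 mu f -> measurable [set x | 0 < f x].
  move=> Lf; rewrite -[X in measurable X]setTI; apply: measurable_fun_ltr => //.
  exact: L2_measurable Lf.
have ub (a b : R) n : 0 < b -> Num.min (n%:R * Num.max a 0) b <= b * (0 < a)%R%:R.
  move=> b0; case: (ltP 0 a) => a0; first by rewrite mulr1 ge_min lexx orbT.
  by rewrite mulr0 mulr0 ge_min lexx.
have lub (a b y : R) : 0 < b -> (forall n, Num.min (n%:R * Num.max a 0) b <= y) ->
    b * (0 < a)%R%:R <= y.
  move=> b0 h; case: (ltP 0 a) h => a0 h.
    (* For n >= b / a the truncation has already reached b. *)
    rewrite mulr1; have := h (Num.bound (b / a)); rewrite min_r//.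
    rewrite -ler_pdivrMr//; apply/ltW/archi_boundP.
    by rewrite divr_ge0// ltW.
  by rewrite mulr0; have := h 0%N; rewrite mul0r min_l// ltW.
have Lup := L2_max Lu (L2_0 mu).
pose g_ n y := Num.min (n%:R * Num.max (u y) 0) (w y).
have Lg n : L2 mu (g_ n) by apply: L2_min => //; exact: L2Z.
have Pg : {ae mu, forall x, forall n, P (g_ n) x = Num.min (n%:R * Num.max (P u x) 0) (P w x)}.
  apply: ae_foralln => n.
  apply: filterS3 (oi_min (L2Z n%:R Lup) Lw) (oiZ n%:R Lup) (oi_pos_part Lu).
  by move=> x -> -> ->.
rewrite /corresponds; apply: (@oi_sup g_) => //.
- by apply: L2_indic => //; exact: mpos.
- by apply: L2_indic; [exact/mpos/(oi_L2 isoP)|exact: (oi_L2 isoP)].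
- by move=> x n; rewrite indicb; exact: ub.
- by move=> x y; rewrite indicb; exact: lub.
- by apply: filterS2 Pg oi_gt0 => x h Pw n; rewrite indicb h; exact: ub.
- apply: filterS2 Pg oi_gt0 => x h Pw y h1; rewrite indicb; apply: lub => // n.
  by rewrite -h.
Qed.

Lemma corresponds_super g q : L2 mu g ->
  corresponds [set x | q * w x < g x] [set x | q * P w x < P g x].
Proof.
move=> Lg; have LZ := L2Z q Lw.
have -> : [set x | q * w x < g x] = [set x | 0 < g x - q * w x].
  by apply/seteqP; split=> x /=; rewrite subr_gt0.
apply: corresponds_ae (corresponds_pos (L2B Lg LZ)) _.
apply: filterS2 (oiB Lg LZ) (oiZ q Lw) => x /= -> ->.
by rewrite subr_gt0.
Qed.

End weight.
End order_isomorphism.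

(** * Point realization of an order isomorphism *)

Lemma measurable_sqrtr (R : realType) : measurable_fun setT (@Num.sqrt R).
Proof. by apply: continuous_measurable_fun => x; exact: sqrt_continuous. Qed.

Lemma preimage_measurable (d d' : measure_display) (X : measurableType d)
    (Y : measurableType d') (f : X -> Y) (B : set Y) :
  measurable_fun setT f -> measurable B -> measurable (f @^-1` B).
Proof. by move=> mf mB; rewrite -[_ @^-1` _]setTI; exact: mf. Qed.

Lemma ae_comp (d d' : measure_display) (X : measurableType d) (Y : measurableType d')
    (R : realType) (mu : {measure set X -> \bar R}) (nu : {measure set Y -> \bar R})
    (T : X -> Y) (Q : Y -> Prop) :
  measurable_fun setT T ->
  (forall N, measurable N -> nu N = 0%E -> mu (T @^-1` N) = 0%E) ->
  {ae nu, forall y, Q y} -> {ae mu, forall x, Q (T x)}.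
Proof.
move=> mT nsT [N [mN N0 QN]]; exists (T @^-1` N); split.
- exact: preimage_measurable.
- exact: nsT.
- by move=> x /= h; apply: QN.
Qed.

Lemma measurable_fun_divr (d : measure_display) (X : measurableType d) (R : realType)
    (f g : X -> R) : measurable_fun setT f -> measurable_fun setT g ->
  measurable_fun setT (fun x => f x / g x).
Proof.
(* [powR] is measurable and agrees with the inverse on nonnegative reals, hence the detour through
   g^2. Where g vanishes both sides are 0. *)
move=> mf mg; have -> : (fun x => f x / g x) = (fun x => f x * (g x * (g x ^+ 2) `^ (-1))).
  apply/funext => x; rewrite powR_inv1 ?sqr_ge0//.
  have [->|g0] := eqVneq (g x) 0; first by rewrite invr0 mul0r.
  by congr (_ * _); rewrite expr2 invfM mulVKf.
apply: measurable_funM => //; apply: measurable_funM => //.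
by apply: (measurableT_comp (measurable_powR _)); exact: measurable_funX.
Qed.

Lemma sigma_finite_partition (d : measure_display) (X : measurableType d) (R : realType)
    (mu : {measure set X -> \bar R}) : sigma_finite setT mu ->
  exists D : nat -> set X, [/\ forall n, measurable (D n), trivIset setT D,
    \bigcup_n D n = setT & forall n, (mu (D n) < +oo)%E].
Proof.
move=> [F FT mF]; exists (seqDU F); split.
- by apply: seqDU_measurable => k; exact: (mF k).1.
- exact: trivIset_seqDU.
- by rewrite -seqDU_bigcup_eq -FT.
- move=> n; apply: le_lt_trans (mF n).2.
  apply: le_measure; rewrite ?inE//; [|exact: (mF n).1|exact: subset_seqDU].
  by apply: seqDU_measurable => k; exact: (mF k).1.
Qed.

Lemma sigma_finite_weight (d : measure_display) (X : measurableType d) (R : realType)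
    (mu : {measure set X -> \bar R}) (phi : X -> R) :
  sigma_finite setT mu -> measurable_fun setT phi ->
  exists w : X -> R, [/\ forall x, 0 < w x, L2 mu w & L2 mu (fun x => w x * phi x)].
Proof.
move=> /sigma_finite_partition[D [mD tD DT Doo]] mphi.
have Dfin n : mu (D n) \is a fin_num by rewrite ge0_fin_numE.
(* Chosen so that b_n^2 mu (D_n) <= 2^-(n+1), where the sum converges; the added 1 covers pieces of
   measure 0. *)
pose c n : R := (1 + fine (mu (D n)))^-1.
have c1 n : 0 < 1 + fine (mu (D n)) by rewrite ltr_pwDl// fine_ge0.
pose b n : R := Num.sqrt (1 / (2 ^ n.+1)%:R * c n).
have b2_gt0 n : 0 < 1 / (2 ^ n.+1)%:R * c n.
  by rewrite mulr_gt0 ?invr_gt0// divr_gt0// ltr0n expn_gt0.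
have idx x : {n | D n x}.
  apply: cid; have : (\bigcup_n D n) x by rewrite DT.
  by case=> n _ ?; exists n.
pose v x := b (sval (idx x)).
have vD n x : D n x -> v x = b n.
  move=> Dnx; rewrite /v; case: (idx x) => m /= Dmx.
  by congr b; apply: (tD m n) => //; exists x.
have v_gt0 x : 0 < v x by rewrite /v /b sqrtr_gt0.
have mv : measurable_fun setT v.
  rewrite -DT; apply/measurable_fun_bigcup => // n.
  apply: (@eq_measurable_fun _ _ _ _ _ (cst (b n))) => [x|]; last exact: measurable_cst.
  by rewrite inE => /vD.
have Lv : L2 mu v.
  apply/L2P; split=> //.
  have mv2 : measurable_fun setT (fun x : X => (v x ^+ 2)%:E).
    by apply/measurable_EFinP; exact: measurable_funX.
  rewrite -DT ge0_integral_bigcup//; [|by rewrite DT|by move=> x _; rewrite lee_fin sqr_ge0].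
  apply: (@le_lt_trans _ _ (\sum_(n <oo) (1 / (2 ^ n.+1)%:R)%:E)%E); last first.
    apply: le_lt_trans (epsilon_trick0 xpredT ler01) _; exact: ltry.
  apply: lee_nneseries => [n _ _|n _]; first by apply: integral_ge0 => x _; rewrite lee_fin sqr_ge0.
  rewrite (@eq_integral _ _ _ mu (D n) (cst (b n ^+ 2)%:E)); last first.
    by move=> x; rewrite inE => /vD ->.
  rewrite integral_cst// -[mu (D n)]fineK// -EFinM lee_fin /b sqr_sqrtr ?(ltW (b2_gt0 n))//.
  rewrite -(mulrA (1 / _)) ler_piMr ?divr_ge0//.
  by rewrite /c mulrC ler_pdivrMr// mul1r lerDr.
(* This division bounds both w and |w phi| by v. *)
pose w x := v x / (1 + `|phi x|).
have p1 x : 0 < 1 + `|phi x| by rewrite ltr_pwDl.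
have mw : measurable_fun setT w.
  apply: measurable_fun_divr => //.
  by apply: measurable_funD => //; exact: measurableT_comp.
exists w; split=> [x||].
- by rewrite divr_gt0.
- apply: L2_le Lv _ => // x.
  rewrite /w normrM ler_piMr// normfV (ger0_norm (ltW (p1 x))) invf_le1//.
  by rewrite lerDl.
- apply: L2_le Lv _ => [|x]; first exact: measurable_funM.
  rewrite /w -mulrA normrM ler_piMr// normrM normfV (ger0_norm (ltW (p1 x))).
  by rewrite mulrC ler_pdivrMr// mul1r lerDr.
Qed.

Section realization.
Context (d : measure_display) (X : measurableType d) (R : realType)
  (mu : {measure set X -> \bar R}) (P : (X -> R) -> (X -> R)) (w : X -> R)
  (phi : X -> R).
Hypotheses (isoP : order_iso mu P) (Lw : L2 mu w) (w_gt0 : forall x, 0 < w x)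
  (mphi : measurable_fun setT phi) (iphi : injective phi)
  (mphiI : forall A, measurable A -> measurable (phi @` A))
  (Lwphi : L2 mu (fun x => w x * phi x)).

(** If P g = (P w) ((g / w) o T), the choice g = w phi gives psi = phi o T. As phi is injective, psi
    determines T. *)
Let psi x := P (fun y => w y * phi y) x / P w x.

Let mpsi : measurable_fun setT psi.
Proof.
by apply: measurable_fun_divr; apply: (@L2_measurable _ _ _ mu); exact: (oi_L2 isoP).
Qed.

Lemma corresponds_borel (D : set R) : measurable D ->
  corresponds mu P w (phi @^-1` D) (psi @^-1` D).
Proof.
pose C := [set D : set R | measurable D /\
  corresponds mu P w (phi @^-1` D) (psi @^-1` D)].
suff H : (@ocitv R).-sigma.-measurable `<=` C by move=> mD; exact: (H D mD).2.
rewrite RGenOInfty.measurableE; apply: smallest_sub => [|_ [q ->]].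
  split.
  - split=> //; rewrite !preimage_set0.
    have := correspondsC isoP Lw measurableT (correspondsT mu P w).
    by rewrite setCT.
  - move=> D' [mD' cD']; rewrite setTD; split; first exact: measurableC.
    apply: (correspondsC isoP Lw) cD'.
    exact: preimage_measurable.
  - move=> D' cD'; split; first by apply: bigcup_measurable => n _; exact: (cD' n).1.
    rewrite !preimage_bigcup; apply: corresponds_bigcup => // n.
    + by apply: preimage_measurable => //; exact: (cD' n).1.
    + by apply: preimage_measurable => //; exact: (cD' n).1.
    + exact: (cD' n).2.
split; first exact: measurable_itv.
have := corresponds_super isoP Lw w_gt0 q Lwphi.
have -> : [set x | q * w x < w x * phi x] = phi @^-1` `]q, +oo[.
  by apply/seteqP; split=> x /=; rewrite in_itv/= andbT mulrC ltr_pM2l.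
move=> H; apply: corresponds_ae H _.
apply: filterS (oi_gt0 isoP Lw w_gt0) => x Pw /=.
by rewrite in_itv/= andbT /psi ltr_pdivlMr.
Qed.

Lemma point_map_exists : exists2 T : X -> X, measurable_fun setT T &
  forall A, measurable A -> corresponds mu P w A (T @^-1` A).
Proof.
(* T is phi^-1 o psi. The default x, which asks for no base point and keeps T measurable, is used
   only on a null set. *)
pose T x := if pselect (exists y, phi y = psi x) is left h then sval (cid h) else x.
have TE x : range phi (psi x) -> phi (T x) = psi x.
  by move=> [y _ yx]; rewrite /T; case: pselect => [h|[]]; [exact: svalP (cid h)|exists y].
have TN x : ~ range phi (psi x) -> T x = x.
  by move=> h; rewrite /T; case: pselect => // -[y yx]; case: h; exists y.
have mr : measurable (range phi) by exact: mphiI.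
have Tpre A : T @^-1` A = psi @^-1` (phi @` A) `|` (A `&` psi @^-1` (~` range phi)).
  apply/seteqP; split=> x /=.
    have [h|h] := pselect (range phi (psi x)).
      by move=> ATx; left; exists (T x); rewrite ?TE.
    by rewrite TN// => Ax; right.
  move=> [[y Ay yx]|[Ax /TN ->//]].
  suff -> : T x = y by [].
  by apply: iphi; rewrite TE//; exists y.
exists T.
  move=> _ A mA; rewrite setTI Tpre; apply: measurableU.
    by apply: preimage_measurable => //; exact: mphiI.
  apply: measurableI => //; apply: preimage_measurable => //.
  exact: measurableC.
(* The whole space corresponds both to itself and to psi^-1 (range phi), so uniqueness makes the
   latter conull. *)
have rae : {ae mu, forall x, range phi (psi x)}.
  have := corresponds_borel mr.
  have -> : phi @^-1` range phi = setT by apply/seteqP; split=> x //= _; exists x.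
  move=> h; have := corresponds_uniq isoP Lw w_gt0 (correspondsT mu P w) h.
  by apply: filterS => x [+ _]; exact.
move=> A mA; have := corresponds_borel (mphiI mA).
have -> : phi @^-1` (phi @` A) = A.
  by apply/seteqP; split=> x /= => [[y Ay /iphi <-//]|Ax]; exists x.
move=> h; apply: corresponds_ae h _; rewrite Tpre.
by apply: filterS rae => x rx; split=> [?|[|[]]//]; left.
Qed.

Lemma realization : exists T : X -> X, [/\ measurable_fun setT T,
  forall N, measurable N -> mu N = 0%E -> mu (T @^-1` N) = 0%E &
  forall g, L2 mu g -> {ae mu, forall x, P g x = P w x * (g (T x) / w (T x))}].
Proof.
have [T mT corrT] := point_map_exists; exists T.
have Pw_gt0 := oi_gt0 isoP Lw w_gt0.
split=> // [N mN N0|g Lg].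
  have mTN : measurable (T @^-1` N) by exact: preimage_measurable.
  apply/(negligibleP mu mTN).
  have w0 : {ae mu, forall x, w x * \1_N x = 0}.
    exists N; split=> // x /= h; apply: contrapT => Nx; apply: h.
    by rewrite indic_notin ?mulr0.
  move/(oi_eq isoP (L2_indic mN Lw) (L2_0 mu)): w0 => Pw0.
  have := corrT N mN; rewrite /corresponds => cN.
  suff : {ae mu, forall x, ~ (T @^-1` N) x}.
    by rewrite /prop_near1 /= /almost_everywhere; congr negligible; apply/seteqP;
      split=> x /=; [exact: contrapT|move=> ? h; exact: h].
  apply: filterS2 Pw_gt0 (filterI (filterI Pw0 cN) (oi_0 isoP)) => x Pw [[h0 h1] h2] TNx.
  have : P w x = 0 by rewrite -h2 -h0 h1 (indic_mem _ TNx) mulr1.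
  by move=> h3; rewrite h3 ltxx in Pw.
(* Indexing the rationals by naturals lets one null set serve all thresholds. Off it, g / w at T x
   and P g / P w at x exceed the same rationals, hence agree. The default 0 only repeats a
   threshold. *)
pose q n : R := if @unpickle rat n is Some r then ratr r else 0.
have key : {ae mu, forall x, forall n, (q n * w (T x) < g (T x)) <-> (q n * P w x < P g x)}.
  apply: ae_foralln => n.
  have mS : measurable [set x | q n * w x < g x].
    rewrite -[X in measurable X]setTI; apply: measurable_fun_ltr => //.
      by apply: measurable_funM => //; exact: L2_measurable Lw.
    exact: L2_measurable Lg.
  exact: (corresponds_uniq isoP Lw w_gt0 (corrT _ mS) (corresponds_super isoP Lw w_gt0 (q n) Lg)).
apply: filterS2 key Pw_gt0 => x h Pw.
rewrite mulrC; apply/(canRL (mulfVK (lt0r_neq0 Pw))).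
have h' (r : rat) : (ratr r < g (T x) / w (T x)) = (ratr r < P g x / P w x).
  have /= := h (pickle r); rewrite /q pickleK.
  rewrite (ltr_pdivlMr _ _ (w_gt0 _)) (ltr_pdivlMr _ _ Pw) => hr.
  by apply/idP/idP => /hr.
have lt_absurd (a b : R) : (forall r : rat, (ratr r < a) = (ratr r < b)) -> ~ a < b.
  move=> H ab; have [r] := rat_in_itvoo ab.
  by rewrite in_itv/= => /andP[ar rb]; move: rb; rewrite -H => /(lt_trans ar); rewrite ltxx.
apply/le_anti/andP; split; rewrite leNgt; apply/negP; exact: lt_absurd.
Qed.

End realization.

(** * A null copy of the line in a non-atomic space *)

Lemma geometric_half_sum (R : realType) (m : R) :
  (\sum_(n <oo) (m / (2 ^ n.+1)%:R)%:E)%E = m%:E.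
Proof.
have /cvg_lim := @cvg_geometric_eseries_half R m 0.
rewrite expr0 divr1 => <- //; congr (limn _); apply/funext => n.
by rewrite /eseries/=; apply: eq_bigr => i _; rewrite addn1.
Qed.

Section continuity_of_measures.
Context (d : measure_display) (X : measurableType d) (R : realType)
  (mu : {measure set X -> \bar R}) (F : nat -> set X).
Hypothesis mF : forall n, measurable (F n).

Lemma measure_bigcap_lt (e : \bar R) : (mu (F 0%N) < +oo)%E -> nonincreasing_seq F ->
  (mu (\bigcap_n F n) < e)%E -> exists n, (mu (F n) < e)%E.
Proof.
move=> Foo ndF Fe; apply: contrapT => nF.
move: Fe; rewrite ltNge => /negP; apply.
apply: cvge_ge (nonincreasing_cvg_mu Foo mF (bigcapT_measurable mF) ndF).
apply: nearW => n /=; rewrite leNgt; apply/negP => h; apply: nF.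
by exists n.
Qed.

Lemma measure_bigcup_le (e : \bar R) : nondecreasing_seq F ->
  (forall n, (mu (F n) <= e)%E) -> (mu (\bigcup_n F n) <= e)%E.
Proof.
move=> ndF Fe.
apply: cvge_le (nondecreasing_cvg_mu mF (bigcupT_measurable _ mF) ndF).
exact: nearW.
Qed.

End continuity_of_measures.

(** The sets that can be approximated from both sides form a sigma-algebra containing the rays;
    complements exchange the roles of the closed and the open set. *)
Lemma finite_measure_regular (R : realType) (nu : {measure set R -> \bar R})
    (D : set R) (e : R) :
  (nu setT < +oo)%E -> measurable D -> 0 < e ->
  exists C U, [/\ closed C, open U, C `<=` D, D `<=` U & (nu (U `\` C) < e%:E)%E].
Proof.
move=> nuT.
have fin A : measurable A -> (nu A < +oo)%E.
  by move=> mA; apply: le_lt_trans nuT; apply: le_measure; rewrite ?inE.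
pose reg := [set D : set R | forall e, 0 < e -> exists C U,
  [/\ closed C, open U, C `<=` D, D `<=` U & (nu (U `\` C) < e%:E)%E]].
move=> mD e0; suff H : (@ocitv R).-sigma.-measurable `<=` reg by exact: (H D mD e e0).
rewrite RGenOInfty.measurableE; apply: smallest_sub => [|_ [q ->]].
  split=> [r r0|A rA|A rA] /=.
  - exists set0, set0; split; [exact: closed0|exact: open0|by []|by []|].
    by rewrite setD0 measure0 lte_fin.
  - rewrite setTD => r r0; have [C [U [cC oU CA AU CU]]] := rA r r0.
    exists (~` U), (~` C); split; first exact: open_closedC.
    + exact: closed_openC.
    + exact: subsetC.
    + exact: subsetC.
    + by rewrite setDE setCK setIC -setDE.
  - move=> r r0; have r2 : 0 < r / 2 by rewrite divr_gt0.
    have rn n : 0 < (r / 2) / (2 ^ n.+1)%:R by rewrite divr_gt0// ltr0n expn_gt0.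
    have /choice[C HC] : forall n, exists C, exists U, [/\ closed C, open U, C `<=` A n,
        A n `<=` U & (nu (U `\` C) < ((r / 2) / (2 ^ n.+1)%:R)%:E)%E].
      by move=> n; have [C [U HCU]] := rA n _ (rn n); exists C, U.
    have /choice[U HU] := HC => {HC}.
    have mC n : measurable (C n) by apply: closed_measurable; have [] := HU n.
    have mU n : measurable (U n) by apply: open_measurable; have [] := HU n.
    (* An infinite union of closed sets need not be closed, so only finitely many C i are kept. The
       sets V n decrease to a subset of the union of the U k \ C k, whose mass is at most r / 2, so
       some V n has mass below r. *)
    pose V n := \bigcup_k U k `\` \big[setU/set0]_(i < n) C i.
    have mbU : measurable (\bigcup_k U k) by exact: bigcupT_measurable.
    have mV n : measurable (V n).
      by apply: measurableD => //; apply: bigsetU_measurable => i _.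
    have [|||n Vn] := @measure_bigcap_lt _ _ _ nu V mV r%:E.
    + exact: fin.
    + move=> i j ij; apply/subsetPset; apply: setDS; exact: subset_bigsetU.
    + apply: (@le_lt_trans _ _ (r / 2)%:E); last first.
        by rewrite lte_fin ltr_pdivrMr// ltr_pMr// ltr1n.
      have VE : \bigcap_n V n `<=` \bigcup_k (U k `\` C k).
        move=> x Vx; have [[k _ Ukx] _] := Vx 0%N Logic.I.
        exists k => //; split=> // Ckx; have [_] := Vx k.+1 Logic.I; apply.
        by rewrite big_ord_recr/=; right.
      apply: (@le_trans _ _ (nu (\bigcup_k (U k `\` C k)))).
        apply: le_measure => //; rewrite inE; first exact: bigcapT_measurable.
        by apply: bigcupT_measurable => k; exact: measurableD.
      apply: (@le_trans _ _ (\sum_(k <oo) nu (U k `\` C k))%E).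
        apply: measure_sigma_subadditive => //.
          by move=> k; exact: measurableD.
        by apply: bigcupT_measurable => k; exact: measurableD.
      apply: le_trans (epsilon_trick0 xpredT (ltW r2)).
      apply: lee_nneseries => [k _ _|k _]; first exact: measure_ge0.
      by apply/ltW; have [] := HU k.
    + exists (\big[setU/set0]_(i < n) C i), (\bigcup_k U k); split=> //.
      * by apply: closed_bigsetU => i _; have [] := HU i.
      * by apply: bigcup_open => i _; have [] := HU i.
      * apply: (@subset_trans _ (\bigcup_k C k)); first exact: bigsetU_bigcup.
        by apply: subset_bigcup => i _; have [] := HU i.
      * by apply: subset_bigcup => i _; have [] := HU i.
(* V n is the part of the open ray missed by the closed ray from q + 1/(n+1); these intervals shrink
   to the empty set. *)
move=> r r0 /=; pose V n : set R := `]q, q + n.+1%:R^-1[%classic.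
have mV n : measurable (V n) by exact: measurable_itv.
have [|||n Vn] := @measure_bigcap_lt _ _ _ nu V mV r%:E.
- exact: fin.
- move=> i j ij; apply/subsetPset => x; rewrite /V /= !in_itv/= => /andP[-> h].
  by apply: lt_le_trans h _; rewrite lerD2l lef_pV2 ?posrE// ler_nat.
- have -> : \bigcap_n V n = set0.
    rewrite -subset0 => x Vx; have := Vx 0%N Logic.I; rewrite /V /= in_itv/= => /andP[qx _].
    have xq : 0 < x - q by rewrite subr_gt0.
    have := Vx (Num.bound (x - q)^-1) Logic.I; rewrite /V /= in_itv/= qx/=.
    rewrite -ltrBlDl ltNge => /negP; apply.
    rewrite invf_ple ?posrE//.
    apply: le_trans (ltW (archi_boundP _)) _; first by rewrite invr_ge0 ltW.
    by rewrite ler_nat.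
  by rewrite measure0 lte_fin.
exists `[q + n.+1%:R^-1, +oo[%classic, `]q, +oo[%classic; split.
- exact: interval_closed.
- exact: interval_open.
- move=> x /=; rewrite !in_itv/= !andbT; apply: lt_le_trans.
  by rewrite ltrDl invr_gt0.
- by [].
- rewrite (_ : _ `\` _ = V n)//; apply/seteqP; split=> x; rewrite /V /= !in_itv/= !andbT.
    by move=> [-> /negP]; rewrite -ltNge.
  by move=> /andP[-> h]; split=> //; apply/negP; rewrite -ltNge.
Qed.

(* c is the distribution function of the sum of the masses m / 2^(n+1) at the
   rationals q_n; the intervals [l_n, u_n[ are its jumps.  Their total length
   is m, so that the range of c is null in [0, m]. *)
Lemma jump_function (R : realType) (m : R) : 0 < m ->
  exists (c : R -> R) (l u : nat -> R), [/\
    forall r r', r < r' -> c r < c r',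
    forall r, 0 < c r < m,
    forall n, [/\ 0 < l n, l n + m / (2 ^ n.+1)%:R <= u n & u n < m],
    forall n r, c r < l n \/ u n <= c r &
    forall n k, n != k -> u n <= l k \/ u k <= l n].
Proof.
move=> m0.
have [q qi qs] : exists2 q : nat -> rat, injective q & forall r, exists n, q n = r.
  have /pcard_eqP/bijPex[f bijf] := card_rat.
  pose g := 'pinv_(fun => 0%R) [set: rat] f.
  have gf r : g (f r) = r by rewrite /g pinvKV ?inE//; exact: set_bij_inj bijf.
  have fg n : f (g n) = n.
    have [r _ <-] : (f @` setT) n by rewrite (image_eq bijf).
    by rewrite gf.
  exists g; first exact: can_inj fg.
  by move=> r; exists (f r).
have a_ge0 n : 0 <= m / (2 ^ n.+1)%:R by rewrite divr_ge0// ltW.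
pose kap : {measure set R -> \bar R} :=
  mseries (fun n => mscale (NngNum (a_ge0 n)) (@dirac _ R (ratr (q n)) R)) 0.
have kE A : kap A = (\sum_(n <oo) (m / (2 ^ n.+1)%:R)%:E * (\1_A (ratr (q n)))%:E)%E.
  by [].
have kT : kap setT = m%:E.
  rewrite kE -[RHS]geometric_half_sum; apply: eq_eseriesr => n _.
  by rewrite indicE in_setT mule1.
have kfin A : measurable A -> kap A \is a fin_num.
  move=> mA; rewrite ge0_fin_numE//; apply: (@le_lt_trans _ _ (kap setT)).
    by apply: le_measure; rewrite ?inE.
  by rewrite kT ltry.
have k1 n : ((m / (2 ^ n.+1)%:R)%:E <= kap [set ratr (q n)])%E.
  rewrite kE (@nneseriesD1 _ _ n)//; last by move=> k _; rewrite mule_ge0 ?lee_fin ?indicE.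
  rewrite indicE mem_set// mule1 leeDl//; apply: nneseries_ge0 => k _ _.
  by rewrite mule_ge0 ?lee_fin ?indicE.
pose F A := fine (kap A).
have Fmono A B : measurable A -> measurable B -> A `<=` B -> F A <= F B.
  move=> mA mB AB; apply: fine_le; rewrite ?kfin//.
  by apply: le_measure; rewrite ?inE.
have F0 : F set0 = 0 by rewrite /F measure0.
have FT : F setT = m by rewrite /F kT.
have step (A B : set R) n : measurable A -> measurable B -> A `<=` B -> B (ratr (q n)) ->
    ~ A (ratr (q n)) -> F A + m / (2 ^ n.+1)%:R <= F B.
  move=> mA mB AB Bq Aq.
  apply: le_trans (Fmono (A `|` [set ratr (q n)]) B _ _ _); last 3 first.
  - exact: measurableU.
  - exact: mB.
  - by move=> x [/AB//|->].
  rewrite /F measureU//; last by rewrite -subset0 => x [Ax /= xq]; apply: Aq; rewrite -xq.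
  rewrite fineD ?kfin// lerD2l -lee_fin fineK ?kfin//.
have a_gt0 n : 0 < m / (2 ^ n.+1)%:R by rewrite divr_gt0// ltr0n expn_gt0.
(* Every rational carries an atom of [kap], so a rational separating two rays makes the comparison
   of their masses strict. *)
have stepr (A B : set R) (r : rat) : measurable A -> measurable B -> A `<=` B -> B (ratr r) ->
    ~ A (ratr r) -> F A < F B.
  move=> mA mB AB Br Ar; have [n qr] := qs r; apply: (lt_le_trans _ (@step A B n mA mB AB _ _)).
  - by rewrite ltrDl.
  - by rewrite qr.
  - by rewrite qr.
(* l n and u n are the masses of the open and the closed ray at q n, so u n is the value of c there.
   The range of c meets the closed jump only at its right end, which is why jumps are half-open. *)
exists (fun r => F `]-oo, r]%classic), (fun n => F `]-oo, ratr (q n)[%classic),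
  (fun n => F `]-oo, ratr (q n)]%classic); split.
- move=> r r' rr'; have [s] := rat_in_itvoo rr'; rewrite in_itv/= => /andP[rs sr].
  apply: (stepr _ _ s) => //=; rewrite ?in_itv/=.
  + by move=> x /=; rewrite !in_itv/= => /le_trans; apply; exact: ltW.
  + exact: ltW.
  + by apply/negP; rewrite -ltNge.
- move=> r; apply/andP; split.
    have [|s] := @rat_in_itvoo R (r - 1) r; first by rewrite ltrBlDr ltrDl.
    rewrite in_itv/= => /andP[_ sr]; rewrite -F0.
    by apply: (stepr _ _ s) => //=; rewrite in_itv/= ltW.
  have [|s] := @rat_in_itvoo R r (r + 1); first by rewrite ltrDl.
  rewrite in_itv/= => /andP[rs _]; rewrite -FT.
  by apply: (stepr _ _ s) => //=; apply/negP; rewrite in_itv/= -ltNge.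
- move=> n; set x : R := ratr (q n); split.
  + have [|s] := @rat_in_itvoo R (x - 1) x; first by rewrite ltrBlDr ltrDl.
    rewrite in_itv/= => /andP[_ sr]; rewrite -F0.
    by apply: (stepr _ _ s) => //=; rewrite in_itv.
  + apply: step => //=; rewrite ?in_itv/= ?ltxx//.
    by move=> y /=; rewrite !in_itv/=; exact: ltW.
  + have [|s] := @rat_in_itvoo R x (x + 1); first by rewrite ltrDl.
    rewrite in_itv/= => /andP[rs _]; rewrite -FT.
    by apply: (stepr _ _ s) => //=; apply/negP; rewrite in_itv/= -ltNge.
- move=> n r; case: (ltP r (ratr (q n))) => rq.
    left; have [s] := rat_in_itvoo rq; rewrite in_itv/= => /andP[rs sq].
    apply: (stepr _ _ s) => //=; rewrite ?in_itv//=.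
    + by move=> y /=; rewrite !in_itv/= => /le_lt_trans; apply.
    + by apply/negP; rewrite -ltNge.
  by right; apply: Fmono => // y /=; rewrite !in_itv/= => /le_trans; apply.
- have mono n k : q n < q k -> F `]-oo, ratr (q n)]%classic <= F `]-oo, ratr (q k)[%classic.
    move=> nk; apply: Fmono => // y /=; rewrite !in_itv/= => /le_lt_trans; apply.
    by rewrite ltr_rat.
  move=> n k nk; case: (ltgtP (q n) (q k)) => [/mono|/mono|/qi/eqP]; [by left|by right|].
  by rewrite (negbTE nk).
Qed.

Lemma measurable_left_inverse (d : measure_display) (X : measurableType d) (R : realType)
    (phi : X -> R) (x0 : X) : injective phi ->
  (forall A, measurable A -> measurable (phi @` A)) ->
  exists2 g : R -> X, measurable_fun setT g & cancel phi g.
Proof.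
move=> iphi mphiI.
pose g t := if pselect (range phi t) is left h then s2val (cid2 h) else x0.
have gphi : cancel phi g.
  move=> x; rewrite /g; case: pselect => [h|[]]; last by exists x.
  by case: (cid2 h) => y /= _ /iphi.
exists g => // _ A mA; rewrite setTI.
have mr : measurable (range phi) by exact: mphiI.
have -> : g @^-1` A = phi @` A `|` (~` range phi `&` [set _ | A x0]).
  apply/seteqP; split=> t /=.
    have [[y _ <-]|h] := pselect (range phi t); first by rewrite gphi; left; exists y.
    by rewrite /g; case: pselect => // _ Ax0; right.
  move=> [[y Ay <-]|[h Ax0]]; first by rewrite gphi.
  by rewrite /g; case: pselect.
apply: measurableU; first exact: mphiI.
apply: measurableI; first exact: measurableC.
have [Ax0|Ax0] := pselect (A x0).
  by rewrite (_ : [set _ | _] = setT)//; apply/seteqP; split.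
by rewrite (_ : [set _ | _] = set0)//; apply/seteqP; split.
Qed.

Section quantile.
Context (d : measure_display) (X : measurableType d) (R : realType)
  (mu : {measure set X -> \bar R}) (phi : X -> R) (E : set X).
Hypotheses (mphi : measurable_fun setT phi) (mE : measurable E)
  (Eoo : (mu E < +oo)%E) (phi0 : forall t, mu (phi @^-1` [set t]) = 0%E)
  (cE : closed (phi @` E)).

Let L t := E `&` [set x | phi x <= t].
Let G t := fine (mu (L t)).
Let m := fine (mu E).
Let s v := inf [set t | v <= G t].

Let mle t : measurable [set x | phi x <= t].
Proof.
by rewrite -[X in measurable X]setTI; apply: measurable_fun_ler => //; exact: measurable_cst.
Qed.

Let mlt t : measurable [set x | phi x < t].
Proof.
by rewrite -[X in measurable X]setTI; apply: measurable_fun_ltr => //; exact: measurable_cst.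
Qed.

Let mL t : measurable (L t).
Proof. exact: measurableI. Qed.

Let fin A : measurable A -> A `<=` E -> mu A \is a fin_num.
Proof.
move=> mA AE; rewrite ge0_fin_numE//; apply: le_lt_trans Eoo.
by apply: le_measure; rewrite ?inE.
Qed.

Let GE t : mu (L t) = (G t)%:E.
Proof. by rewrite fineK// fin//; exact: subIsetl. Qed.

Let muE : mu E = m%:E.
Proof. by rewrite fineK// fin. Qed.

Let G_nd t t' : t <= t' -> G t <= G t'.
Proof.
move=> tt'; rewrite -lee_fin -!GE; apply: le_measure; rewrite ?inE//.
by apply: setIS => x /= /le_trans; apply.
Qed.

(** Nullity of the fibres of phi enters here: it adds left continuity of G to the right continuity
    that any finite measure gives. *)
Let mu_lt t : mu (E `&` [set x | phi x < t]) = mu (L t).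
Proof.
apply/eqP; rewrite eq_le; apply/andP; split.
  apply: le_measure; rewrite ?inE//; first exact: measurableI.
  by apply: setIS => x /= /ltW.
have mt : measurable (phi @^-1` [set t]) by exact: preimage_measurable.
rewrite -[leRHS]adde0 -(phi0 t) -measureU//; last 2 first.
- exact: measurableI.
- by rewrite -subset0 => x [[_ /= +] /= e]; rewrite e ltxx.
apply: le_measure; rewrite ?inE//.
  by apply: measurableU => //; exact: measurableI.
by move=> x [Ex /=]; rewrite le_eqVlt => /orP[/eqP|]; [right|left].
Qed.

Let invS n : 0 < n.+1%:R^-1 :> R.
Proof. by rewrite invr_gt0. Qed.

Let invS_le n k : (n <= k)%N -> k.+1%:R^-1 <= n.+1%:R^-1 :> R.
Proof. by move=> nk; rewrite lef_pV2 ?posrE// ler_nat. Qed.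

Let invS_small (e : R) : 0 < e -> exists n, n.+1%:R^-1 < e.
Proof.
move=> e0; exists (Num.bound e^-1).
rewrite invf_plt ?posrE//; apply: lt_le_trans (archi_boundP _) _.
  by rewrite invr_ge0 ltW.
by rewrite ler_nat.
Qed.

Section value.
Context (v : R) (v0 : 0 < v) (vm : v < m).

(** The bound v < m makes the set nonempty, since L n increases to E; 0 < v bounds it below, since L
    (-n) decreases to the empty set. *)
Let A_has_inf : has_inf [set t | v <= G t].
Proof.
split.
  apply: contrapT => h.
  have Gv t : G t < v by rewrite ltNge; apply/negP => ?; apply: h; exists t.
  have : (mu (\bigcup_n L n%:R) <= v%:E)%E.
    apply: measure_bigcup_le => // [i j ij|n].
      by apply/subsetPset; apply: setIS => x /= /le_trans; apply; rewrite ler_nat.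
    by rewrite GE lee_fin ltW.
  have -> : \bigcup_n L n%:R = E.
    apply/seteqP; split=> [x [n _ []//]|x Ex].
    exists (Num.bound `|phi x|) => //; split=> //=.
    exact: le_trans (ler_norm _) (ltW (archi_boundP (normr_ge0 _))).
  by rewrite muE lee_fin leNgt vm.
have [||||n Ln] := @measure_bigcap_lt _ _ _ mu (fun n => L (- n%:R)) _ v%:E.
- by move=> n; exact: mL.
- by rewrite GE ltry.
- move=> i j ij; apply/subsetPset; apply: setIS => x /= /le_trans; apply.
  by rewrite lerN2 ler_nat.
- rewrite (_ : \bigcap_n _ = set0) ?measure0 ?lte_fin//.
  rewrite -subset0 => x h; have [_ /=] := h (Num.bound `|phi x|) Logic.I.
  rewrite lerNr leNgt => /negP; apply.
  by apply: le_lt_trans (archi_boundP (normr_ge0 _)); rewrite -normrN ler_norm.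
exists (- n%:R) => t /= vt; rewrite leNgt; apply/negP => tn.
move: Ln; rewrite GE lte_fin ltNge => /negP; apply.
by apply: le_trans vt _; apply: G_nd; exact: ltW.
Qed.

Let G_s_ge : v <= G (s v).
Proof.
rewrite leNgt; apply/negP => Gv.
have [||||n Ln] := @measure_bigcap_lt _ _ _ mu (fun n => L (s v + n.+1%:R^-1)) _ v%:E.
- by move=> n; exact: mL.
- by rewrite GE ltry.
- move=> i j ij; apply/subsetPset; apply: setIS => x /= /le_trans; apply.
  by rewrite lerD2l invS_le.
- rewrite (_ : \bigcap_n _ = L (s v)) ?GE ?lte_fin//.
  apply/seteqP; split=> [x h|x [Ex /= xs] n _]; last first.
    by split=> //=; apply: le_trans xs _; rewrite lerDl ltW.
  split; first by have [] := h 0%N Logic.I.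
  rewrite /= leNgt; apply/negP => sx.
  have [|n ne] := @invS_small (phi x - s v); first by rewrite subr_gt0.
  have [_ /=] := h n Logic.I; rewrite -lerBlDl leNgt => /negP; apply.
  by [].
have [t /= vt] := inf_adherent (invS n) A_has_inf.
rewrite -/(s v) => ts; move: Ln; rewrite GE lte_fin ltNge => /negP; apply.
by apply: le_trans vt _; apply: G_nd; exact: ltW.
Qed.

Lemma quantile_galois t : (v <= G t) = (s v <= t).
Proof.
apply/idP/idP => [vt|st]; first by apply: inf_lbound => //; have [] := A_has_inf.
by apply: le_trans G_s_ge _; exact: G_nd.
Qed.

(** Right continuity gives one inequality. For the other, G < v strictly to the left of s v, and the
    fibre over s v itself has no mass. *)
Lemma cdf_quantile : G (s v) = v.
Proof.
apply/le_anti; rewrite G_s_ge andbT -lee_fin -GE -mu_lt.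
have -> : E `&` [set x | phi x < s v] = \bigcup_n L (s v - n.+1%:R^-1).
  apply/seteqP; split=> [x [Ex /= xs]|x [n _ [Ex /= xs]]].
    have [|n ne] := @invS_small (s v - phi x); first by rewrite subr_gt0.
    by exists n => //; split=> //=; rewrite lerBrDr -lerBrDl ltW.
  by split=> //=; apply: le_lt_trans xs _; rewrite ltrBlDr ltrDl.
apply: measure_bigcup_le => // [i j ij|n].
  apply/subsetPset; apply: setIS => x /= /le_trans; apply.
  by rewrite lerD2l lerN2 invS_le.
rewrite GE lee_fin ltW// ltNge quantile_galois -ltNge.
by rewrite ltrBlDr ltrDl.
Qed.

(** Outside the closed set phi E, the point s v would have a neighbourhood free of values of phi on
    E. G would be constant between s v - e / 2 and s v, so level v would be reached to the left of
    the infimum. *)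
Lemma quantile_in_range : (phi @` E) (s v).
Proof.
apply: contrapT => nK.
have : nbhs (s v) (~` (phi @` E)) by apply: open_nbhs_nbhs; split; [exact: closed_openC|].
move=> /nbhs_ballP[e /= e0 be].
have e2 : 0 < e / 2 by rewrite divr_gt0.
have LE : L (s v - e / 2) = L (s v).
  apply/seteqP; split=> x [Ex /= xs]; split=> //=.
    by apply: le_trans xs _; rewrite lerBlDr lerDl ltW.
  rewrite leNgt; apply/negP => sx.
  have : ball (s v) e (phi x).
    rewrite /ball/= ger0_norm ?subr_ge0//.
    rewrite ltrBlDr -ltrBlDl; apply: le_lt_trans sx; rewrite lerD2l lerN2.
    by rewrite ler_pdivrMr// ler_peMr ?ltW// ltr1n.
  by move/be; apply; exists x.
have : s v <= s v - e / 2 by rewrite -quantile_galois /G LE; exact: G_s_ge.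
by rewrite leNgt ltrBlDr ltrDl e2.
Qed.

(** Since G (phi x) < v means phi x < s v, the function G o phi is uniformly distributed on E. Thus
    the preimage of a jump has the length of the jump as its measure. *)
Lemma measure_cdf_lt : mu (E `&` [set x | G (phi x) < v]) = v%:E.
Proof.
rewrite -{2}cdf_quantile -GE -mu_lt; congr (mu (_ `&` _)).
by apply/seteqP; split=> x /=; rewrite !ltNge quantile_galois.
Qed.

End value.

Let quantile_le v v' : 0 < v < m -> 0 < v' < m -> v <= v' -> s v <= s v'.
Proof.
move=> /andP[v0 vm] /andP[v0' vm'] vv'.
by rewrite -(quantile_galois v0 vm) (cdf_quantile v0' vm').
Qed.

(* J r is the quantile of order c r, with c a jump function: its values avoid
   the preimages of the jumps of c, which exhaust the measure of E.  The
   closedness of phi E is what makes every quantile a value of phi. *)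
Lemma null_copy (g : R -> X) : (0 < mu E)%E -> measurable_fun setT g -> cancel phi g ->
  exists (J : R -> X) (rho : X -> R) (N : set X), [/\ measurable_fun setT J,
    measurable_fun setT rho, measurable N /\ mu N = 0%E, N `<=` E &
    (forall r, N (J r)) /\ (forall r, 0 <= r <= 1 -> rho (J r) = r)].
Proof.
move=> E0 mg phiK.
have m0 : 0 < m by rewrite -lte_fin -muE.
have [c [l [u [c_lt c_in lu c_gap lu_disj]]]] := jump_function m0.
have c_le r r' : r <= r' -> c r <= c r'.
  by rewrite le_eqVlt => /orP[/eqP->//|/c_lt/ltW].
(* A left inverse of c on [0, 1], monotone and hence measurable. Including 0 and confining r to
   [0, 1] makes the supremum exist for every v. *)
pose h v := sup [set r | r = 0 \/ (0 <= r <= 1 /\ c r <= v)].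
have h_ub v : has_sup [set r | r = 0 \/ (0 <= r <= 1 /\ c r <= v)].
  split; first by exists 0; left.
  by exists 1 => r /= [->//|[/andP[]]].
have h_nd v v' : v <= v' -> h v <= h v'.
  move=> vv'; apply: le_sup => // [r /= hr|]; last by exists 0; left.
  exists r; split=> //.
  by case: hr => [->|[r01 cr]]; [left|right; split=> //; exact: le_trans vv'].
have hc r : 0 <= r <= 1 -> h (c r) = r.
  move=> r01; apply/le_anti/andP; split; last first.
    by apply: ub_le_sup; [have [] := h_ub (c r)|right].
  apply: ge_sup; first by have [] := h_ub (c r).
  move=> r' /= [->|[_ cr]]; first by case/andP: r01.
  by rewrite leNgt; apply/negP => /c_lt; rewrite ltNge cr.
have mGphi : measurable_fun setT (G \o phi).
  by apply: measurableT_comp => //; exact: nondecreasing_measurable.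
pose gap n := (E `&` [set x | G (phi x) < u n]) `\` (E `&` [set x | G (phi x) < l n]).
have mGlt v : measurable (E `&` [set x | G (phi x) < v]).
  apply: measurableI => //; rewrite -[X in measurable X]setTI.
  by apply: measurable_fun_ltr => //; exact: measurable_cst.
have mgap n : measurable (gap n) by exact: measurableD.
have mbgap : measurable (\bigcup_n gap n) by exact: bigcupT_measurable.
have gapE n x : gap n x -> l n <= G (phi x) < u n.
  by move=> [[Ex /= ->] h']; rewrite andbT leNgt; apply/negP => ?; apply: h'.
have gap_ge n : ((m / (2 ^ n.+1)%:R)%:E <= mu (gap n))%E.
  have [l0 lnu um] := lu n.
  have lun : l n < u n by apply: lt_le_trans lnu; rewrite ltrDl divr_gt0// ltr0n expn_gt0.
  have lu_sub : E `&` [set x | G (phi x) < l n] `<=` E `&` [set x | G (phi x) < u n].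
    by move=> x [Ex /= Gl]; split=> //=; exact: lt_trans lun.
  have muu : mu (E `&` [set x | G (phi x) < u n]) = (u n)%:E.
    by apply: measure_cdf_lt => //; exact: lt_trans lun.
  have mul : mu (E `&` [set x | G (phi x) < l n]) = (l n)%:E.
    by apply: measure_cdf_lt => //; exact: lt_trans um.
  have uoo : (mu (E `&` [set x | (G (phi x) < u n)%R]) < +oo)%E by rewrite muu ltry.
  have := measureD (mGlt (u n)) (mGlt (l n)) uoo; rewrite (setIidr lu_sub) => gapn.
  have {gapn} : mu (gap n) = (mu (E `&` [set x | (G (phi x) < u n)%R]) -
    mu (E `&` [set x | (G (phi x) < l n)%R]))%E := gapn.
  by rewrite muu mul => ->; rewrite -EFinB lee_fin lerBrDl.
have gap_disj : trivIset setT gap.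
  move=> n k _ _ [x [/gapE/andP[nl nu] /gapE/andP[kl ku]]].
  apply/eqP; apply: contrapT => /negP nk; case: (lu_disj n k nk) => H.
    by have := lt_le_trans nu (le_trans H kl); rewrite ltxx.
  by have := lt_le_trans ku (le_trans H nl); rewrite ltxx.
pose N := E `\` \bigcup_n gap n.
have gapS : \bigcup_n gap n `<=` E by move=> x [n _ [[]]].
have mN : measurable N by exact: measurableD.
have muN : mu N = 0%E.
  have gm : (m%:E <= mu (\bigcup_n gap n))%E.
    rewrite measure_bigcup// (@eq_eseriesl _ _ xpredT (fun n => mu (gap n)) 0%N); last first.
      by move=> n; rewrite in_setT.
    rewrite -(geometric_half_sum m).
    apply: lee_nneseries => [n _ _|n _]; last exact: gap_ge.
    by rewrite lee_fin divr_ge0// ltW.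
  have : (mu N + mu (\bigcup_n gap n) <= mu E)%E.
    by rewrite -measureU// ?setDKI// /N setDKU.
  have Nf : mu N \is a fin_num by apply: fin => //; exact: subDsetl.
  have gf : mu (\bigcup_n gap n) \is a fin_num by exact: fin.
  move: gm; rewrite muE -(fineK Nf) -(fineK gf) -EFinD !lee_fin => gm h'.
  apply/eqP; rewrite eqe; apply/eqP/le_anti; rewrite fine_ge0// andbT.
  by move: gm h'; set a := fine _; set b := fine _; lra.
have phiJ r : phi (g (s (c r))) = s (c r).
  have /andP[c0 cm] := c_in r.
  by have [x _ <-] := quantile_in_range c0 cm; rewrite phiK.
exists (g \o s \o c), (h \o G \o phi), N; split.
- apply: (measurableT_comp (f := g)) => //.
  by apply: nondecreasing_measurable => // r r' rr'; apply: quantile_le; rewrite ?c_in ?c_le.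
- apply: (measurableT_comp (f := h)) => //.
  by apply: nondecreasing_measurable => // v v'; exact: h_nd.
- by [].
- exact: subDsetl.
- have GJ r : G (phi (g (s (c r)))) = c r.
    by have /andP[c0 cm] := c_in r; rewrite phiJ cdf_quantile.
  split=> r /=; last by move=> r01; rewrite GJ hc.
  have /andP[c0 cm] := c_in r; split.
    by have [x Ex <-] := quantile_in_range c0 cm; rewrite phiK.
  move=> [n _ /gapE]; rewrite GJ => /andP[lc cu].
  by case: (c_gap n r) => H; [move: lc; rewrite leNgt H|move: cu; rewrite ltNge H].
Qed.

End quantile.

(** * Bijections onto conull sets *)

Lemma measurable_fun_case (d d' : measure_display) (X : measurableType d)
    (Y : measurableType d') (A : set X) (f g : X -> Y) :
  measurable A -> measurable_fun setT f -> measurable_fun setT g ->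
  measurable_fun setT (fun x => if pselect (A x) then f x else g x).
Proof.
move=> mA mf mg _ B mB; rewrite setTI.
have -> : (fun x => if pselect (A x) then f x else g x) @^-1` B =
    (A `&` f @^-1` B) `|` (~` A `&` g @^-1` B).
  apply/seteqP; split=> x /=.
    by case: pselect => Ax; [left|right].
  by case: pselect => Ax; case=> -[].
apply: measurableU; apply: measurableI => //; try exact: preimage_measurable.
exact: measurableC.
Qed.

(** The map t / (1 + |t|) squeezes the line into ]-1, 1[, and 3/4 + u/4 carries this to ]1/2, 1[.
    That interval is disjoint from its successive halves, as a shift by halving requires. *)
Lemma compressed_code (d : measure_display) (X : measurableType d) (R : realType)
    (phi : X -> R) (g : R -> X) :
  measurable_fun setT phi -> measurable_fun setT g -> cancel phi g ->
  exists (enc : X -> R) (dec : R -> X), [/\ measurable_fun setT enc,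
    measurable_fun setT dec, cancel enc dec & forall x, 2^-1 < enc x < 1].
Proof.
move=> mphi mg phiK.
have p1 x : 0 < 1 + `|phi x| by rewrite ltr_pwDl.
pose u x := phi x / (1 + `|phi x|).
have u1 x : `|u x| < 1.
  by rewrite /u normrM normfV (gtr0_norm (p1 x)) ltr_pdivrMr// mul1r ltrDr.
exists (fun x => 3 / 4 + 1 / 4 * u x), (fun r => g ((4 * r - 3) / (1 - `|4 * r - 3|))).
split.
- apply: measurable_funD => //; apply: measurable_funM => //.
  apply: measurable_fun_divr => //; apply: measurable_funD => //.
  exact: measurableT_comp.
- have ml : measurable_fun setT (fun r : R => 4 * r - 3).
    by apply: measurable_funB => //; exact: measurable_funM.
  apply: (measurableT_comp (f := g)) => //; apply: measurable_fun_divr => //.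
  by apply: measurable_funB => //; exact: measurableT_comp.
- move=> x /=; have -> : 4 * (3 / 4 + 1 / 4 * u x) - 3 = u x by field.
  rewrite -[RHS]phiK; congr g.
  have -> : 1 - `|u x| = (1 + `|phi x|)^-1.
    rewrite /u normrM normfV (gtr0_norm (p1 x)); field.
    exact: lt0r_neq0.
  by rewrite invrK /u mulfVK// lt0r_neq0.
- by move=> x; have := u1 x; rewrite ltr_norml => /andP[h1 h2]; apply/andP; split; lra.
Qed.

Section conull.
Context (d : measure_display) (X : measurableType d) (R : realType)
  (mu : {measure set X -> \bar R}).

(** A fibre of phi has at most one point, so it cannot be split and would be an atom if its measure
    were positive. *)
Lemma nonatomic_point (phi : X -> R) (t : R) : measurable_fun setT phi ->
  injective phi -> nonatomic mu -> mu (phi @^-1` [set t]) = 0%E.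
Proof.
move=> mphi iphi na; have mA : measurable (phi @^-1` [set t]) by exact: preimage_measurable.
apply: contrapT => h; apply: (na (phi @^-1` [set t])); split=> //; split.
  by rewrite lt0e measure_ge0 andbT; apply/eqP.
move=> B mB BA; have [[x Bx]|/forallNP Bx] := pselect (exists x, B x).
  right; rewrite (_ : _ `\` _ = set0) ?measure0// -subset0 => y [/= yt]; apply.
  by rewrite (_ : y = x)//; apply: iphi; rewrite yt (BA x Bx).
by left; rewrite (_ : B = set0) ?measure0// -subset0 => x /Bx.
Qed.

Lemma closed_piece (phi : X -> R) (Z : set X) : measurable_fun setT phi -> injective phi ->
  (forall A, measurable A -> measurable (phi @` A)) ->
  sigma_finite setT mu -> mu setT <> 0%E -> measurable Z -> mu (~` Z) = 0%E ->
  exists E, [/\ measurable E, E `<=` Z, (0 < mu E)%E, (mu E < +oo)%E &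
    closed (phi @` E)].
Proof.
move=> mphi iphi mphiI [F FT mF] mu0 mZ Z0.
have [n Fn] : exists n, mu (F n `&` Z) <> 0%E.
  apply: contrapT => /forallNP h; apply: mu0; apply/(negligibleP mu measurableT).
  rewrite (_ : setT = ~` Z `|` \bigcup_n (F n `&` Z)).
    apply: negligibleU; first by apply/(negligibleP mu (measurableC mZ)).
    apply: negligible_bigcup => n; apply/negligibleP; last exact: contrapT (h n).
    by apply: measurableI => //; exact: (mF n).1.
  apply/seteqP; split=> // x _; have [Zx|] := pselect (Z x); last by left.
  have : (\bigcup_n F n) x by rewrite -FT.
  by case=> n _ Fnx; right; exists n.
pose A := F n `&` Z.
have mA : measurable A by apply: measurableI => //; exact: (mF n).1.
have Aoo : (mu A < +oo)%E.
  apply: le_lt_trans (mF n).2; apply: le_measure; rewrite ?inE//; first exact: (mF n).1.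
  exact: subIsetl.
have Af : mu A \is a fin_num by rewrite ge0_fin_numE.
have A0 : 0 < fine (mu A) by rewrite fine_gt0// Aoo andbT lt0e measure_ge0 andbT; apply/eqP.
pose nu_ : {measure set R -> \bar R} := pushforward (mrestr mu mA) phi.
pose nu := nu_ mphi.
have nuE D : nu D = mu (phi @^-1` D `&` A) by [].
(* The error allowed is the whole mass of A: a closed set missing strictly less than that keeps
   positive mass. *)
have [|C [U [cC oU CA AU CU]]] :=
  @finite_measure_regular R nu (phi @` A) (fine (mu A)) _ (mphiI A mA) A0.
  by rewrite nuE preimage_setT setTI.
have mC : measurable C by exact: closed_measurable.
have mU : measurable U by exact: open_measurable.
pose E := phi @^-1` C `&` A.
have mE : measurable E by apply: measurableI => //; exact: preimage_measurable.
have EA : E `<=` A by exact: subIsetr.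
exists E; split=> //.
- by move=> x /EA [].
- rewrite lt0e measure_ge0 andbT; apply/eqP => E0.
  move: CU; rewrite nuE fineK// ltNge => /negP; apply.
  have mUC : measurable (phi @^-1` (U `\` C) `&` A).
    by apply: measurableI => //; apply: preimage_measurable => //; exact: measurableD.
  rewrite -[leRHS]adde0 -E0 -measureU//; last first.
    by rewrite -subset0 => x [[[_ nC] _] [Cx _]]; exact: nC.
  apply: le_measure; rewrite ?inE//; first exact: measurableU.
  move=> x Ax; have [Cx|nCx] := pselect (C (phi x)); [by right|left].
  by split=> //; split=> //; apply: AU; exists x.
- by apply: le_lt_trans Aoo; apply: le_measure; rewrite ?inE.
- rewrite (_ : phi @` E = C)//; apply/seteqP; split=> [_ [x [Cx _] <-]//|t Ct].
  by have [x Ax xt] := CA t Ct; exists x => //; split=> //=; rewrite xt.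
Qed.

(* Hilbert hotel: a point x of the complement of Z moves to the point J r of the
   null copy with r = enc x in ]1/2, 1[, and each J (2^-n r) to J (2^-(n+1) r). *)
Lemma conull_bijection (phi : X -> R) (Z : set X) : measurable_fun setT phi ->
  injective phi -> (forall A, measurable A -> measurable (phi @` A)) ->
  sigma_finite setT mu -> nonatomic mu -> mu setT <> 0%E ->
  measurable Z -> mu (~` Z) = 0%E ->
  exists a a' : X -> X, [/\ measurable_fun setT a, measurable_fun setT a',
    forall x, Z (a x), (cancel a a' /\ forall z, Z z -> a (a' z) = z) &
    {ae mu, forall x, a x = x} /\ {ae mu, forall x, a' x = x}].
Proof.
move=> mphi iphi mphiI sf na mu0 mZ Z0.
have [E [mE EZ E0 Eoo cE]] := closed_piece mphi iphi mphiI sf mu0 mZ Z0.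
have [x0 _] : E !=set0 by apply/set0P/eqP => E_0; move: E0; rewrite E_0 measure0 ltxx.
have [g mg phiK] := measurable_left_inverse x0 iphi mphiI.
have phi0 t := nonatomic_point t mphi iphi na.
have [J [rho [N [mJ mrho [mN N0] NE [NJ rhoJ]]]]] := null_copy mphi mE Eoo phi0 cE E0 mg phiK.
have [enc [dec [menc mdec encK enc12]]] := compressed_code mphi mg phiK.
pose M := ~` Z.
have mM : measurable M by exact: measurableC.
have JZ r : Z (J r) by exact/EZ/NE.
(* This is the image of M by [enc], written with [dec] so that its measurability reduces to
   preimages. *)
pose code := [set r | M (dec r) /\ enc (dec r) = r].
have meqR (f h : R -> R) : measurable_fun setT f -> measurable_fun setT h ->
    measurable [set r | f r = h r].
  move=> mf mh; rewrite (_ : [set r | _] = [set r | f r == h r]).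
    by rewrite -[X in measurable X]setTI; exact: measurable_fun_eqr.
  by apply/seteqP; split=> r /eqP.
have meqX (f h : X -> X) : measurable_fun setT f -> measurable_fun setT h ->
    measurable [set x | f x = h x].
  move=> mf mh; rewrite (_ : [set x | _] = [set x | phi (f x) == phi (h x)]).
    rewrite -[X in measurable X]setTI; apply: measurable_fun_eqr => //; exact: measurableT_comp.
  by apply/seteqP; split=> x /=; [move=> ->|move=> /eqP/iphi].
have mcode : measurable code.
  apply: measurableI; first exact: (preimage_measurable mdec mM).
  by apply: meqR => //; exact: measurableT_comp.
have code12 r : code r -> 2^-1 < r < 1 by move=> [_ <-].
have encM x : M x -> code (enc x) by move=> Mx; split; rewrite encK.
(* The codes and their iterated halves. L and L0 below are the images of [orb] and [code] by J,
   again described through the left inverse [rho]. *)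
pose orb := [set r : R | exists n, code (2 ^+ n * r)].
have morb : measurable orb.
  rewrite (_ : orb = \bigcup_n ((fun r : R => 2 ^+ n * r) @^-1` code)).
    apply: bigcupT_measurable => n; apply: preimage_measurable => //.
    exact: measurable_funM.
  by apply/seteqP; split=> [r [n ?]|r [n _ ?]]; exists n.
have orb01 r : orb r -> 0 < r < 1.
  move=> [n /code12/andP[h1 h2]].
  have p0 : 0 < 2 ^+ n :> R by rewrite exprn_gt0.
  have r0 : 0 < r by rewrite -(pmulr_rgt0 _ p0) (lt_trans _ h1).
  rewrite r0/=; apply: le_lt_trans h2.
  by rewrite ler_peMl ?(ltW r0)// exprn_ege1// ler1n.
have orb_half r : orb r -> orb (r / 2).
  move=> [n h]; exists n.+1.
  by have -> : 2 ^+ n.+1 * (r / 2) = 2 ^+ n * r by rewrite exprSr; field.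
have orb_double r : orb r -> ~ code r -> orb (2 * r).
  move=> [[|n] h]; first by rewrite expr0 mul1r in h.
  by move=> _; exists n; rewrite mulrA -exprSr.
have code_orb r : code r -> orb r by exists 0%N; rewrite expr0 mul1r.
pose L := [set x | J (rho x) = x /\ orb (rho x)].
have mL : measurable L.
  apply: measurableI; first by apply: meqX => //; exact: measurableT_comp.
  exact: (preimage_measurable mrho morb).
pose L0 := [set x | J (rho x) = x /\ code (rho x)].
have mL0 : measurable L0.
  apply: measurableI; first by apply: meqX => //; exact: measurableT_comp.
  exact: (preimage_measurable mrho mcode).
have rhoJorb r : orb r -> rho (J r) = r.
  by move=> /orb01/andP[r0 r1]; apply: rhoJ; rewrite !ltW.
have JL r : orb r -> L (J r) by move=> ro; rewrite /L /= rhoJorb.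
have L0L x : L0 x -> L x by move=> [h1 /code_orb h2].
have ML x : L x -> ~ M x by move=> [<- _]; apply; exact: JZ.
pose a x := if pselect (M x) then J (enc x) else
  if pselect (L x) then J (rho x / 2) else x.
pose a' x := if pselect (L0 x) then dec (rho x) else
  if pselect (L x) then J (2 * rho x) else x.
have aM x : M x -> a x = J (enc x).
  by move=> Mx; rewrite /a; case: (pselect (M x)).
have aL x : L x -> a x = J (rho x / 2).
  move=> Lx; rewrite /a; case: (pselect (M x)) => [Mx|?]; first by case: (ML x Lx).
  by case: (pselect (L x)).
have aN x : ~ M x -> ~ L x -> a x = x.
  by move=> nM nL; rewrite /a; case: (pselect (M x)) => // ?; case: (pselect (L x)).
have a'L0 x : L0 x -> a' x = dec (rho x).
  by move=> L0x; rewrite /a'; case: (pselect (L0 x)).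
have a'L x : ~ L0 x -> L x -> a' x = J (2 * rho x).
  by move=> nL0 Lx; rewrite /a'; case: (pselect (L0 x)) => // ?; case: (pselect (L x)).
have a'N x : ~ L x -> a' x = x.
  move=> nL; rewrite /a'; case: (pselect (L0 x)) => [/L0L//|?].
  by case: (pselect (L x)).
have LN x : L x -> N x by move=> [<- _].
have M0 : {ae mu, forall x, ~ M x} by exists M; split=> // x /contrapT.
have N_0 : {ae mu, forall x, ~ N x} by exists N; split=> // x /contrapT.
exists a, a'; split.
- apply: measurable_fun_case => //; first exact: (measurableT_comp mJ menc).
  apply: measurable_fun_case => //; apply: (measurableT_comp mJ).
  exact: measurable_funM.
- apply: measurable_fun_case => //; first exact: (measurableT_comp mdec mrho).
  apply: measurable_fun_case => //; apply: (measurableT_comp mJ).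
  exact: measurable_funM.
- move=> x; have [Mx|nMx] := pselect (M x); first by rewrite aM.
  have [Lx|nLx] := pselect (L x); first by rewrite aL.
  by rewrite aN//; exact: contrapT nMx.
- split=> [x|z Zz].
    have [Mx|nMx] := pselect (M x).
      have ce := encM x Mx; have oe := code_orb _ ce.
      by rewrite aM// a'L0 ?rhoJorb ?encK// /L0 /= rhoJorb.
    have [Lx|nLx] := pselect (L x); last by rewrite aN// a'N.
    have [Jx ox] := Lx; have oh := orb_half _ ox.
    (* Half of a number below 1 is below 1/2, hence not a code: a' never mistakes a shifted point
       for a newcomer from M. *)
    have nc : ~ L0 (J (rho x / 2)).
      move=> [_]; rewrite rhoJorb// => /code12/andP[h _].
      by have /andP[_] := orb01 _ ox; move: h; lra.
    rewrite aL// a'L//; last exact: JL.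
    by rewrite rhoJorb// mulrC mulfVK.
  have nMz : ~ M z by [].
  have [L0z|nL0] := pselect (L0 z).
    have [Jz [Mz ez]] := L0z.
    by rewrite a'L0// aM// ez.
  have [Lz|nLz] := pselect (L z); last by rewrite a'N// aN.
  have [Jz oz] := Lz.
  have od : orb (2 * rho z) by apply: orb_double => // cz; apply: nL0.
  rewrite a'L// aL; last exact: JL.
  by rewrite rhoJorb// mulrAC mulfV// mul1r.
- split; first by apply: filterS2 M0 N_0 => x nM nN; apply: aN => // /LN.
  by apply: filterS N_0 => x nN; apply: a'N => /LN.
Qed.

End conull.

(** * Weighted composition operators *)

Import HBNNSimple.

Lemma integral_density (d : measure_display) (X : measurableType d) (R : realType)
    (mu nu : {measure set X -> \bar R}) (h G : X -> R) :
  measurable_fun setT h -> (forall x, 0 <= h x) ->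
  (forall B, measurable B -> (\int[mu]_(x in B) (h x)%:E = nu B)%E) ->
  measurable_fun setT G -> (forall x, 0 <= G x) ->
  (\int[mu]_x (G x * h x)%:E = \int[nu]_x (G x)%:E)%E.
Proof.
move=> mh h0 hnu mG G0.
have mGE : measurable_fun setT (EFin \o G) by exact/measurable_EFinP.
have GE0 x : setT x -> (0 <= (EFin \o G) x)%E by rewrite lee_fin.
pose g := nnsfun_approx measurableT mGE.
have gG x : (EFin \o g n) x @[n --> \oo] --> (G x)%:E.
  exact: (cvg_nnsfun_approx measurableT mGE GE0).
have g_nd x a b : (a <= b)%N -> g a x <= g b x.
  by move=> ab; exact/lefP/nd_nnsfun_approx.
transitivity (lim (\int[mu]_x (g n x * h x)%:E @[n --> \oo])%E).
  rewrite -monotone_convergence//.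
  - apply: eq_integral => x _; apply/esym/cvg_lim => //.
    have hfin : (h x)%:E \is a fin_num by [].
    exact: (cvgeZr hfin (gG x)).
  - by move=> n; apply/measurable_EFinP; exact: measurable_funM.
  - by move=> n x _; rewrite lee_fin mulr_ge0.
  - by move=> x _ a b ab; rewrite lee_fin ler_wpM2r// g_nd.
transitivity (lim (\int[nu]_x (g n x)%:E @[n --> \oo])%E); last first.
  rewrite -monotone_convergence//.
  - by apply: eq_integral => x _; apply/cvg_lim => //; exact: gG.
  - by move=> n; exact/measurable_EFinP.
  - by move=> n x _; rewrite lee_fin.
  - by move=> x _ a b ab; rewrite lee_fin g_nd.
suff -> : (fun n => (\int[mu]_x (g n x * h x)%:E)%E) =
    (fun n => (\int[nu]_x (g n x)%:E)%E) by [].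
apply/funext => n.
transitivity (\int[nu]_x
   (\sum_(y \in range (g n)) (y * \1_(g n @^-1` [set y]) x)%:E))%E; last first.
  by apply: eq_integral => t _; rewrite /= [in RHS]fimfunE -fsumEFin.
transitivity (\int[mu]_x
   (\sum_(y \in range (g n)) (y * \1_(g n @^-1` [set y]) x * h x)%:E))%E.
  apply: eq_integral => t _; rewrite /= fimfunE EFinM -fsumEFin// ge0_mule_fsuml => [|y].
    by apply: eq_fsbigr => y _; rewrite EFinM.
  exact: nnfun_muleindic_ge0.
have mi y : measurable (g n @^-1` [set y]) by exact: measurable_sfunP.
have m1 y : measurable_fun setT (fun x => y * \1_(g n @^-1` [set y]) x).
  by apply: measurable_funM => //; exact: measurable_indic.
rewrite ge0_integral_fsum//; last 2 first.
  - by move=> y; apply/measurable_EFinP; exact: measurable_funM.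
  - by move=> y x _; rewrite EFinM mule_ge0 ?lee_fin//; exact: nnfun_muleindic_ge0.
rewrite ge0_integral_fsum//; last 2 first.
  - by move=> y; apply/measurable_EFinP.
  - by move=> y x _; exact: nnfun_muleindic_ge0.
apply: eq_fsbigr => y /set_mem [x _ yx].
have y0 : 0 <= y by rewrite -yx.
transitivity (y%:E * nu (g n @^-1` [set y]))%E.
  rewrite -hnu// [in RHS]integral_mkcond -ge0_integralZl//; last 2 first.
  - apply/(measurable_restrictT (fun x => (h x)%:E)) => //.
    by apply/measurable_EFinP; exact: measurable_funTS.
  - by move=> z _; rewrite erestrict_ge0// => ? _; rewrite lee_fin.
  apply: eq_integral => z _; rewrite patchE indicE; case: ifP => _.
    by rewrite mulr1 EFinM.
  by rewrite mulr0 mul0r mule0.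
under eq_integral do rewrite EFinM.
rewrite ge0_integralZl//.
- by rewrite integral_indic// setIT.
- by apply/measurable_EFinP; exact: measurable_indic.
Qed.

Lemma Re_scale (R : realType) (r : R) (z : R[i]) : complex.Re ((r%:C)%C * z) = r * complex.Re z.
Proof. by case: z => a b /=; rewrite mul0r subr0. Qed.

Lemma Im_scale (R : realType) (r : R) (z : R[i]) : complex.Im ((r%:C)%C * z) = r * complex.Im z.
Proof. by case: z => a b /=; rewrite mul0r addr0. Qed.

Lemma ReD (R : realType) (a b : R[i]) : complex.Re (a + b) = complex.Re a + complex.Re b.
Proof. by case: a; case: b. Qed.

Lemma ImD (R : realType) (a b : R[i]) : complex.Im (a + b) = complex.Im a + complex.Im b.
Proof. by case: a; case: b. Qed.

Section weighted_composition.
Context (d : measure_display) (X : measurableType d) (R : realType)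
  (mu : {measure set X -> \bar R}) (S Sinv : X -> X) (h : X -> R).
Hypothesis SA : Aut2 mu S Sinv h.

Let mS : measurable_fun setT S. Proof. by case: SA => -[]. Qed.
Let mSinv : measurable_fun setT Sinv. Proof. by case: SA => -[]. Qed.
Let SK : cancel S Sinv. Proof. by case: SA => -[]. Qed.
Let SinvK : cancel Sinv S. Proof. by case: SA => -[]. Qed.
Let nsS B : measurable B -> mu B = 0%E <-> mu (S @^-1` B) = 0%E.
Proof. by case: SA => -[_ _ _ _ H] _ _; exact: H. Qed.
Let mh : measurable_fun setT h. Proof. by case: SA => _ []. Qed.
Let h0 x : 0 <= h x. Proof. by case: SA => _ []. Qed.
Let hS B : measurable B -> (\int[mu]_(x in B) (h x)%:E)%E = mu (S @^-1` B).
Proof. by case: SA => _ [_ _ H] _; exact: H. Qed.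
Let Lh : L2 mu (fun x => Num.sqrt (h x) - 1). Proof. by case: SA. Qed.

Lemma ae_aut (Q : X -> Prop) : {ae mu, forall x, Q x} -> {ae mu, forall x, Q (S x)}.
Proof. by apply: ae_comp => // N mN /(nsS mN). Qed.

Lemma ae_aut_inv (Q : X -> Prop) : {ae mu, forall x, Q x} -> {ae mu, forall x, Q (Sinv x)}.
Proof.
apply: ae_comp => // N mN N0; apply/nsS; first exact: preimage_measurable.
rewrite (_ : _ @^-1` _ = N)//; apply/seteqP; split=> x /=; by rewrite SK.
Qed.

Lemma change_of_variable (F : X -> R) : measurable_fun setT F -> (forall x, 0 <= F x) ->
  (\int[mu]_x (h x * F (Sinv x))%:E = \int[mu]_x (F x)%:E)%E.
Proof.
move=> mF F0.
pose nu_ : {measure set X -> \bar R} := pushforward mu S.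
have mFS : measurable_fun setT (F \o Sinv) by exact: measurableT_comp.
have := @integral_density _ _ _ mu (nu_ mS) h (F \o Sinv) mh h0 hS mFS (fun x => F0 _).
under eq_integral do rewrite mulrC.
move=> ->; rewrite ge0_integral_pushforward//; last 2 first.
- exact/measurable_EFinP.
- by move=> x _; rewrite lee_fin; exact: F0.
by rewrite preimage_setT; apply: eq_integral => x _ /=; rewrite SK.
Qed.

(** The integral of h over {h <= 0} is 0, so the preimage of this set by S is null, and
    nonsingularity makes the set itself null. *)
Lemma density_gt0 : {ae mu, forall x, 0 < h x}.
Proof.
have mB : measurable [set x | h x <= 0].
  by rewrite -[X in measurable X]setTI; apply: measurable_fun_ler => //; exact: measurable_cst.
exists [set x | h x <= 0]; split=> //; last by move=> x /= /negP; rewrite -leNgt.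
apply/nsS => //; rewrite -hS//.
by apply: integral0_eq => x /= hx; congr EFin; apply/le_anti; rewrite hx h0.
Qed.

Let wcomp (g : X -> R) x := Num.sqrt (h x) * g (Sinv x).

Let mwcomp g : measurable_fun setT g -> measurable_fun setT (wcomp g).
Proof.
move=> mg; apply: measurable_funM; last exact: measurableT_comp.
by apply: (measurableT_comp (@measurable_sqrtr R)).
Qed.

Lemma integral_wcomp_sqr (g : X -> R) : measurable_fun setT g ->
  (\int[mu]_x ((wcomp g x) ^+ 2)%:E = \int[mu]_x ((g x) ^+ 2)%:E)%E.
Proof.
move=> mg; rewrite -(@change_of_variable (fun x => g x ^+ 2)); last 2 first.
- exact: measurable_funX.
- by move=> x; rewrite sqr_ge0.
by apply: eq_integral => x _; rewrite /wcomp exprMn sqr_sqrtr.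
Qed.

Lemma L2_wcomp (g : X -> R) : L2 mu g -> L2 mu (wcomp g).
Proof.
by move=> /L2P[mg goo]; apply/L2P; split; [exact: mwcomp|rewrite integral_wcomp_sqr].
Qed.

(** Solving for f gives g o S divided by sqrt (h o S). It lies in L2 because the norm identity holds
    for all measurable functions, before either side is known to be finite. *)
Lemma wcomp_surj (g : X -> R) : L2 mu g ->
  exists2 f, L2 mu f & {ae mu, forall x, wcomp f x = g x}.
Proof.
move=> Lg; have mg := L2_measurable Lg.
pose f x := g (S x) / Num.sqrt (h (S x)).
have fg : {ae mu, forall x, wcomp f x = g x}.
  apply: filterS density_gt0 => x hx; rewrite /wcomp /f SinvK mulrC mulfVK//.
  by rewrite lt0r_neq0// sqrtr_gt0.
have mf : measurable_fun setT f.
  apply: measurable_fun_divr; first exact: measurableT_comp.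
  apply: (measurableT_comp (@measurable_sqrtr R)); exact: (measurableT_comp mh mS).
exists f => //; apply/L2P; split=> //; rewrite -integral_wcomp_sqr//.
have /L2P[] // : L2 mu (wcomp f).
apply: (ae_eq_L2 (mwcomp mf) Lg).
by apply: filterS fg => x ->.
Qed.

Lemma Aut2_unitary : unitary_R mu (U_S Sinv h).
Proof.
have LU f : L2C mu f -> L2C mu (U_S Sinv h f).
  move=> [L1 L2']; split.
    have := L2_wcomp L1; congr L2; apply/funext => x.
    by rewrite /U_S Re_scale.
  have := L2_wcomp L2'; congr L2; apply/funext => x.
  by rewrite /U_S Im_scale.
split=> //; split; [|split; [|split; [|split]]].
- move=> f g _ _ /ae_aut_inv; rewrite /aeeq; apply: filterS => x.
  by rewrite /U_S => ->.
- move=> c f g _ _; rewrite /aeeq; apply: aeW => x.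
  by rewrite /U_S mulrDr !mulrA (mulrC c).
- move=> f [/L2_measurable m1 /L2_measurable m2]; rewrite /normsq.
  rewrite -(@change_of_variable (fun x => complex.Re (f x) ^+ 2 + complex.Im (f x) ^+ 2)).
  + apply: eq_integral => x _; rewrite /U_S Re_scale Im_scale !exprMn.
    by rewrite sqr_sqrtr// mulrDr.
  + by apply: measurable_funD; exact: measurable_funX.
  + by move=> x; rewrite addr_ge0// sqr_ge0.
- move=> g [L1 L2'].
  have [f1 Lf1 fg1] := wcomp_surj L1; have [f2 Lf2 fg2] := wcomp_surj L2'.
  exists (fun x => Complex (f1 x) (f2 x)); split=> //.
  rewrite /aeeq; apply: filterS2 fg1 fg2 => x h1 h2.
  apply/eqP; rewrite eq_complex; apply/andP.
  by rewrite /U_S Re_scale Im_scale /= -h1 -h2 /wcomp !eqxx.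
- move=> f [Lf f0]; split; first exact: LU.
  by apply: filterS (ae_aut_inv f0) => x; rewrite /U_S Im_scale => ->; rewrite mulr0.
Qed.

Lemma Aut2_Aff : Aff_R mu (sqrtS'm1 h) (U_S Sinv h).
Proof.
split; last exact: Aut2_unitary.
split; last by apply: aeW.
by split=> //=; exact: L2_0.
Qed.

(** The action satisfies A k + 1 = sqrt h (k o Sinv + 1), and sqrt h is nonnegative, so k >= -1
    gives A k >= -1. As sqrt h > 0 almost everywhere, the solution k of A k = g inherits the bound
    from g. *)
Lemma Aut2_preserves : preserves_Cm1 mu (sqrtS'm1 h) (U_S Sinv h).
Proof.
have [[[Ls1 Ls2] _] [LU _]] := Aut2_Aff.
split=> [f [Lf f1]|g [[Lg1 Lg2] g1]].
  have [Lu1 Lu2] := LU f Lf.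
  split.
    split; rewrite /aff_act.
      by have := L2D Ls1 Lu1; congr L2; apply/funext => x; rewrite ?ReD ?ImD.
    by have := L2D Ls2 Lu2; congr L2; apply/funext => x; rewrite ?ReD ?ImD.
  apply: filterS (ae_aut_inv f1) => x [f0 fm].
  rewrite /aff_act ReD ImD /= /U_S Re_scale Im_scale f0 mulr0 addr0; split=> //.
  have := sqrtr_ge0 (h x) => h_ge; nra.
have Lk := L2B Lg1 Lh; have [k Lk' kg] := wcomp_surj Lk.
have kS : {ae mu, forall x, -1 <= k (Sinv x)}.
  apply: filterS3 density_gt0 kg g1 => x hx; rewrite /wcomp => kx [_ gx].
  have s0 : 0 < Num.sqrt (h x) by rewrite sqrtr_gt0.
  by rewrite -(ler_pM2l s0) kx; lra.
exists (fun x => (k x)%:C%C); split.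
  split; first by split=> //; exact: L2_0.
  by apply: filterS (ae_aut kS) => x; rewrite SK.
rewrite /aeeq; apply: filterS2 kg g1 => x kx [gi _].
apply/eqP; rewrite eq_complex /aff_act ReD ImD /U_S Re_scale Im_scale /= gi.
by rewrite -/(wcomp k x) kx mulr0 addr0 eqxx andbT; apply/eqP; ring.
Qed.

End weighted_composition.

(** * Spatial form of order isomorphisms *)

Section spatial_isomorphism.
Context (d : measure_display) (X : measurableType d) (R : realType)
  (mu : {measure set X -> \bar R}).
Implicit Types (P W : (X -> R) -> (X -> R)).

Lemma order_iso_inverse P : order_iso mu P -> exists W, [/\ order_iso mu W,
  forall g, L2 mu g -> {ae mu, forall x, P (W g) x = g x} &
  forall g, L2 mu g -> {ae mu, forall x, W (P g) x = g x}].
Proof.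
move=> isoP.
(* The value 0 off L2 only makes the choice total. W is chosen function by function, so its
   properties are checked after applying P. *)
have /choice[W HW] : forall g : X -> R, exists k, L2 mu k /\
    (L2 mu g -> {ae mu, forall x, P k x = g x}).
  move=> g; have [Lg|nLg] := pselect (L2 mu g).
    by have [k Lk Pk] := oi_surj isoP Lg; exists k.
  by exists (fun=> 0); split; [exact: L2_0|].
have LW g : L2 mu (W g) by have [] := HW g.
have PW g : L2 mu g -> {ae mu, forall x, P (W g) x = g x} by have [_] := HW g.
have WP g : L2 mu g -> {ae mu, forall x, W (P g) x = g x}.
  by move=> Lg; apply/(oi_eq isoP) => //; exact/PW/(oi_L2 isoP).
exists W; split=> //; split=> [//|a f g Lf Lg|f g Lf Lg|g Lg].
- apply/(oi_eq isoP (LW _) (L2_lin a (LW f) (LW g))).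
  apply: filterS3 (PW _ (L2_lin a Lf Lg)) (oi_lin isoP a (LW f) (LW g))
    (filterI (PW f Lf) (PW g Lg)).
  by move=> x -> -> [-> ->].
- split=> [fg|].
    apply: (oi_reflect isoP) => //.
    by apply: filterS3 (PW f Lf) (PW g Lg) fg => x -> ->.
  move/(oi_homo isoP (LW f) (LW g)) => fg.
  by apply: filterS3 (PW f Lf) (PW g Lg) fg => x -> ->.
- by exists (P g); [exact: (oi_L2 isoP)|exact: WP].
Qed.

(** Expanding P (W g) gives g = k (g / w) o T2 o T1 with a factor k independent of g. The case g = w
    shows k = w, and g = w phi then yields phi (T2 (T1 x)) = phi x. *)
Lemma realization_inverse P W (phi w : X -> R) (T1 T2 : X -> X) :
  (forall g, L2 mu g -> L2 mu (W g)) ->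
  injective phi -> (forall x, 0 < w x) -> L2 mu w -> L2 mu (fun x => w x * phi x) ->
  measurable_fun setT T1 ->
  (forall N, measurable N -> mu N = 0%E -> mu (T1 @^-1` N) = 0%E) ->
  (forall g, L2 mu g -> {ae mu, forall x, P g x = P w x * (g (T1 x) / w (T1 x))}) ->
  (forall g, L2 mu g -> {ae mu, forall x, W g x = W w x * (g (T2 x) / w (T2 x))}) ->
  (forall g, L2 mu g -> {ae mu, forall x, P (W g) x = g x}) ->
  {ae mu, forall x, T2 (T1 x) = x}.
Proof.
move=> LW iphi w_gt0 Lw Lwphi mT1 nsT1 PT WT PW.
have key g : L2 mu g -> {ae mu, forall x,
    g x = P w x * (W w (T1 x) * (g (T2 (T1 x)) / w (T2 (T1 x))) / w (T1 x))}.
  move=> Lg; apply: filterS3 (PW g Lg) (PT _ (LW g Lg)) (ae_comp mT1 nsT1 (WT g Lg)).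
  by move=> x <- -> ->.
apply: filterS2 (key _ Lw) (key _ Lwphi) => x.
have wne y : w y != 0 by exact: lt0r_neq0.
rewrite divff// mulr1 => wE; rewrite [w (T2 _) * _]mulrC mulfK// => wphiE.
apply: iphi; apply: (mulfI (wne x)); rewrite wphiE {1}wE; field.
exact: wne.
Qed.

Lemma spatial_realization P : standard_borel X R -> sigma_finite setT mu ->
  nonatomic mu -> mu setT <> 0%E -> order_iso mu P ->
  exists (S Sinv : X -> X) (w : X -> R), [/\ [/\ measurable_fun setT S,
    measurable_fun setT Sinv, cancel S Sinv & cancel Sinv S],
    forall x, 0 < w x, measurable_fun setT w, L2 mu (P w) &
    {ae mu, forall x, 0 < P w x} /\
    forall g, L2 mu g ->
      {ae mu, forall x, P g x = P w x * (g (Sinv x) / w (Sinv x))}].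
Proof.
move=> [phi [B [_ [mphi [iphi [_ mphiI]]]]]] sf na mu0 isoP.
have [W [isoW PW WP]] := order_iso_inverse isoP.
have [w [w_gt0 Lw Lwphi]] := sigma_finite_weight sf mphi.
have [T1 [mT1 nsT1 PT]] := realization isoP Lw w_gt0 mphi iphi mphiI Lwphi.
have [T2 [mT2 nsT2 WT]] := realization isoW Lw w_gt0 mphi iphi mphiI Lwphi.
have T21 := realization_inverse (oi_L2 isoW) iphi w_gt0 Lw Lwphi mT1 nsT1 PT WT PW.
have T12 := realization_inverse (oi_L2 isoP) iphi w_gt0 Lw Lwphi mT2 nsT2 WT PT WP.
have mfix (T : X -> X) : measurable_fun setT T -> measurable [set x | T x = x].
  move=> mT; rewrite (_ : [set x | _] = [set x | phi (T x) == phi x]).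
    rewrite -[X in measurable X]setTI; apply: measurable_fun_eqr => //.
    exact: measurableT_comp.
  by apply/seteqP; split=> x /=; [move=> ->|move=> /eqP/iphi].
have mX0 := mfix _ (measurableT_comp mT2 mT1).
have mY0 := mfix _ (measurableT_comp mT1 mT2).
have X0n : mu (~` [set x | (T2 \o T1) x = x]) = 0%E.
  by apply/(negligibleP mu (measurableC mX0)).
have Y0n : mu (~` [set x | (T1 \o T2) x = x]) = 0%E.
  by apply/(negligibleP mu (measurableC mY0)).
have [a [a' [ma ma' aX0 [aK a'K] [ae_a ae_a']]]] :=
  conull_bijection mphi iphi mphiI sf na mu0 mX0 X0n.
have [b [b' [mb mb' bY0 [bK b'K] [ae_b ae_b']]]] :=
  conull_bijection mphi iphi mphiI sf na mu0 mY0 Y0n.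
rewrite /= in aX0 a'K bY0 b'K.
(* T1 maps the fixed set of T2 o T1 onto that of T1 o T2, and T2 inverts it there exactly; a and b
   identify X with these two sets. P composes functions with T1, which therefore gives [Sinv]. *)
exists (fun y => a' (T2 (b y))), (fun x => b' (T1 (a x))), w; split=> //.
- split.
  + by apply: (measurableT_comp ma'); exact: (measurableT_comp mT2).
  + by apply: (measurableT_comp mb'); exact: (measurableT_comp mT1).
  + by move=> y /=; rewrite a'K ?bY0// bK.
  + by move=> x /=; rewrite b'K ?aX0// aK.
- exact: L2_measurable Lw.
- exact: (oi_L2 isoP).
- split; first exact: oi_gt0.
  move=> g Lg; apply: filterS3 (PT g Lg) ae_a (ae_comp mT1 nsT1 ae_b').
  by move=> x -> -> ->.
Qed.

Lemma isometric_spatial_realization P : standard_borel X R -> sigma_finite setT mu ->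
  nonatomic mu -> mu setT <> 0%E -> order_iso mu P ->
  (forall g, L2 mu g -> (\int[mu]_x ((P g x) ^+ 2)%:E = \int[mu]_x ((g x) ^+ 2)%:E)%E) ->
  exists (S Sinv : X -> X) (h : X -> R), [/\ nonsing_aut mu S Sinv,
    RN_deriv_push mu S h &
    forall g, L2 mu g -> {ae mu, forall x, P g x = Num.sqrt (h x) * g (Sinv x)}].
Proof.
move=> sb sf na mu0 isoP normP.
have [S [Sinv [w [[mS mSinv SK SinvK] w_gt0 mw LPw [Pw_gt0 PT]]]]] :=
  spatial_realization sb sf na mu0 isoP.
(* P w is positive only almost everywhere; the maximum makes v nonnegative at every point, so that
   sqrt h = v exactly. *)
pose v x := Num.max (P w x) 0 / w (Sinv x).
have v0 x : 0 <= v x by rewrite divr_ge0 ?le_max ?lexx ?orbT// ltW.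
pose h x := v x ^+ 2.
have mv : measurable_fun setT v.
  apply: measurable_fun_divr; last exact: measurableT_comp.
  by apply: measurable_maxr => //; exact: L2_measurable LPw.
have mh : measurable_fun setT h by exact: measurable_funX.
have h0 x : 0 <= h x by exact: sqr_ge0.
have sqrth x : Num.sqrt (h x) = v x by rewrite sqrtr_sqr ger0_norm.
have Ph g : L2 mu g -> {ae mu, forall x, P g x = Num.sqrt (h x) * g (Sinv x)}.
  move=> Lg; apply: filterS2 (PT g Lg) Pw_gt0 => x -> Pw.
  by rewrite sqrth /v max_l ?ltW// mulrAC mulrA.
have mpre (T : X -> X) A : measurable_fun setT T -> measurable A -> measurable (T @^-1` A).
  exact: preimage_measurable.
(* The isometry is applied to 1_A, whose image has square h 1_(Sinv^-1 A). This requires 1_A in L2,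
   so for a general B the set S^-1 B, rather than B, is then cut into pieces of finite measure. *)
have pre_fin A : measurable A -> (mu A < +oo)%E ->
    (\int[mu]_(x in Sinv @^-1` A) (h x)%:E = mu A)%E.
  move=> mA Aoo; have LA := L2_indic1 mA Aoo.
  have := normP _ LA.
  have E x : (\1_A x ^+ 2 = \1_A x :> R).
    by rewrite indicE; case: (_ \in _); rewrite ?expr1n ?expr0n.
  under [RHS]eq_integral do rewrite E.
  rewrite integral_indic// setIT => <-.
  rewrite integral_mkcond; apply: ge0_ae_eq_integral => //.
  - apply/(measurable_restrictT (fun x => (h x)%:E)) => //; first exact: mpre.
    by apply/measurable_EFinP; exact: measurable_funTS.
  - apply/measurable_EFinP; apply: measurable_funX.
    exact: L2_measurable (oi_L2 isoP LA).
  - by move=> x _; apply: erestrict_ge0 => // ? _; rewrite lee_fin.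
  - by move=> x _; rewrite lee_fin sqr_ge0.
  apply: filterS (Ph _ LA) => x -> _; rewrite exprMn E sqr_sqrtr// patchE indicE.
  have -> : (x \in Sinv @^-1` A) = (Sinv x \in A) by apply/idP/idP; rewrite !inE.
  by case: ifP; rewrite ?mulr1 ?mulr0.
have hS B : measurable B -> (\int[mu]_(x in B) (h x)%:E = mu (S @^-1` B))%E.
  move=> mB; have [D [mD tD DT Doo]] := sigma_finite_partition sf.
  pose A n := S @^-1` B `&` D n.
  have mA n : measurable (A n) by apply: measurableI => //; exact: mpre.
  have Aoo n : (mu (A n) < +oo)%E.
    by apply: le_lt_trans (Doo n); apply: le_measure; rewrite ?inE//; exact: subIsetr.
  have SB : S @^-1` B = \bigcup_n A n by rewrite -setI_bigcupr DT setIT.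
  have BE : B = \bigcup_n (Sinv @^-1` A n).
    rewrite -preimage_bigcup -SB; apply/seteqP; split=> x /=; by rewrite SinvK.
  have tA : trivIset setT A by exact: trivIset_setIl.
  rewrite SB measure_bigcup// (@eq_eseriesl _ _ xpredT (fun n => mu (A n)) 0%N); last first.
    by move=> n; rewrite in_setT.
  rewrite {1}BE ge0_integral_bigcup//.
  - by apply: eq_eseriesr => n _; exact: pre_fin.
  - by move=> n; exact: mpre.
  - by apply/measurable_EFinP; exact: measurable_funTS.
  - by move=> x _; rewrite lee_fin.
  - move=> i j _ _ [x [/= Ai Aj]]; apply: (tA i j) => //.
    by exists (Sinv x).
have h_gt0 : {ae mu, forall x, 0 < h x}.
  apply: filterS Pw_gt0 => x Pw; rewrite exprn_gt0// divr_gt0//.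
  by rewrite lt_max Pw.
have mhB B : measurable_fun B (fun x => (h x)%:E).
  by apply/measurable_EFinP; exact: measurable_funTS.
have absh B : (\int[mu]_(x in B) `|(h x)%:E| = \int[mu]_(x in B) (h x)%:E)%E.
  by apply: eq_integral => x _; rewrite gee0_abs ?lee_fin.
exists S, Sinv, h; split=> //; split=> // B mB; rewrite -hS//; split=> [B0|].
  by rewrite -absh; exact: integral_abs_eq0.
rewrite -absh => /(ae_eq_integral_abs mu mB (mhB B)) hB.
apply/(negligibleP mu mB).
have : {ae mu, forall x, ~ B x}.
  by apply: filterS2 hB h_gt0 => x /[swap] hx /[apply] -[] h_0; rewrite h_0 ltxx in hx.
by rewrite /prop_near1 /= /almost_everywhere; congr negligible; apply/seteqP;
  split=> x /=; [exact: contrapT|move=> ? H; exact: H].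
Qed.

End spatial_isomorphism.

(** * Affine maps preserving the cone *)

Definition real_embed (X : Type) (R : realType) (g : X -> R) : X -> R[i] :=
  fun x => ((g x)%:C)%C.

Definition real_part_op (X : Type) (R : realType)
    (V : (X -> R[i]) -> (X -> R[i])) (g : X -> R) : X -> R :=
  fun x => complex.Re (V (real_embed g) x).

(** Were b negative, a large multiple of it would carry a below c. *)
Lemma recession_ge0 (R : realType) (a b c : R) : (forall n, c <= a + n%:R * b) -> 0 <= b.
Proof.
move=> H; rewrite leNgt; apply/negP => b0.
have nb : 0 < - b by rewrite oppr_gt0.
have := H (Num.bound (`|a - c| / - b)).
have := archi_boundP (divr_ge0 (normr_ge0 (a - c)) (ltW nb)).
set n := Num.bound _; rewrite ltr_pdivrMr// => h1 h2.
by have := ler_norm (a - c); lra.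
Qed.

Section unitary_cone.
Context (d : measure_display) (X : measurableType d) (R : realType)
  (mu : {measure set X -> \bar R}) (f : X -> R[i]) (V : (X -> R[i]) -> (X -> R[i])).
Hypotheses (fV : Aff_R mu f V) (CV : preserves_Cm1 mu f V).

Let P := real_part_op V.

Let V_ae g1 g2 : L2C mu g1 -> L2C mu g2 -> aeeq mu g1 g2 -> aeeq mu (V g1) (V g2).
Proof. by case: fV => _ [_ [H _]]; exact: H. Qed.

Let V_lin (a : R[i]) g1 g2 : L2C mu g1 -> L2C mu g2 ->
  aeeq mu (V (fun x => a * g1 x + g2 x)) (fun x => a * V g1 x + V g2 x).
Proof. by case: fV => _ [_ [_ [H _]]]; exact: H. Qed.

Let V_norm g : L2C mu g -> normsq mu (V g) = normsq mu g.
Proof. by case: fV => _ [_ [_ [_ [H _]]]]; exact: H. Qed.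

Let V_surj g : L2C mu g -> exists k, L2C mu k /\ aeeq mu (V k) g.
Proof. by case: fV => _ [_ [_ [_ [_ [H _]]]]]; exact: H. Qed.

Let V_real g : L2real mu g -> L2real mu (V g).
Proof. by case: fV => _ [_ [_ [_ [_ [_ H]]]]]; exact: H. Qed.

Let f_real : L2real mu f. Proof. by case: fV. Qed.

Let LCe (g : X -> R) : L2 mu g -> L2C mu (real_embed g).
Proof. by move=> Lg; split=> //; exact: L2_0. Qed.

Let Lre (g : X -> R) : L2 mu g -> L2real mu (real_embed g).
Proof. by move=> Lg; split; [exact: LCe|exact: aeW]. Qed.

Lemma real_part_L2 g : L2 mu g -> L2 mu (P g).
Proof. by move=> /Lre/V_real[[]]. Qed.

Lemma real_part_opE g : L2 mu g -> aeeq mu (V (real_embed g)) (real_embed (P g)).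
Proof.
move=> /Lre/V_real[_]; rewrite /aeeq; apply: filterS => x V0.
by apply/eqP; rewrite eq_complex /real_embed /= V0 !eqxx.
Qed.

Lemma real_part_lin a g1 g2 : L2 mu g1 -> L2 mu g2 ->
  {ae mu, forall x, P (fun y => a * g1 y + g2 y) x = a * P g1 x + P g2 x}.
Proof.
move=> L1 L2'; have := V_lin (a%:C)%C (LCe L1) (LCe L2').
have -> : (fun x => (a%:C)%C * real_embed g1 x + real_embed g2 x) =
    real_embed (fun y => a * g1 y + g2 y).
  by apply/funext => x; rewrite /real_embed rmorphD rmorphM.
rewrite /aeeq; apply: filterS => x; rewrite /P /real_part_op => ->.
by rewrite ReD Re_scale.
Qed.

Lemma real_part_isometry g : L2 mu g ->
  (\int[mu]_x ((P g x) ^+ 2)%:E = \int[mu]_x ((g x) ^+ 2)%:E)%E.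
Proof.
move=> Lg; have mg := L2_measurable Lg; have mP := L2_measurable (real_part_L2 Lg).
have := V_norm (LCe Lg); rewrite /normsq => H.
transitivity (\int[mu]_x (complex.Re (real_embed g x) ^+ 2 +
    complex.Im (real_embed g x) ^+ 2)%:E)%E; last first.
  by apply: eq_integral => x _ /=; rewrite expr0n addr0.
have [[m1 m2] V0] := V_real (Lre Lg).
rewrite -H; apply: ge0_ae_eq_integral => //.
- by apply/measurable_EFinP; exact: measurable_funX.
- apply/measurable_EFinP; apply: measurable_funD; apply: measurable_funX.
    exact: L2_measurable m1.
  exact: L2_measurable m2.
- by move=> x _; rewrite lee_fin sqr_ge0.
- by move=> x _; rewrite lee_fin addr_ge0// sqr_ge0.
- by apply: filterS V0 => x -> _; rewrite expr0n addr0.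
Qed.

Let P_Z a g : L2 mu g -> {ae mu, forall x, P (fun y => a * g y) x = a * P g x}.
Proof.
move=> Lg; have L0 := L2_0 (R := R) mu.
have E (c : R) (k : X -> R) : (fun y => c * k y + 0) = (fun y => c * k y).
  by apply/funext => y; rewrite addr0.
have := real_part_lin (-1) L0 L0; have := real_part_lin a Lg L0.
rewrite !E; have -> : (fun _ : X => -1 * 0 : R) = fun=> 0 by apply/funext => y; rewrite mulr0.
by apply: filterS2 => x -> ->; rewrite mulN1r addNr addr0.
Qed.

Let P_B g1 g2 : L2 mu g1 -> L2 mu g2 ->
  {ae mu, forall x, P (fun y => g1 y - g2 y) x = P g1 x - P g2 x}.
Proof.
move=> L1 L2'; have := real_part_lin (-1) L2' L1.
have -> : (fun y => -1 * g2 y + g1 y) = fun y => g1 y - g2 y.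
  by apply/funext => x; rewrite mulN1r addrC.
by apply: filterS => x ->; rewrite mulN1r addrC.
Qed.

Let P_inj g1 g2 : L2 mu g1 -> L2 mu g2 ->
  {ae mu, forall x, P g1 x = P g2 x} -> {ae mu, forall x, g1 x = g2 x}.
Proof.
move=> L1 L2' g12; have LB := L2B L1 L2'.
have PB0 : {ae mu, forall x, P (fun y => g1 y - g2 y) x = 0}.
  by apply: filterS2 (P_B L1 L2') g12 => x -> ->; rewrite subrr.
have mPB := L2_measurable (real_part_L2 LB).
have : {ae mu, forall x, g1 x - g2 x = 0}.
  apply: L2_eq0 => //; rewrite -(real_part_isometry LB).
  rewrite (ge0_ae_eq_integral (g := cst 0%E) measurableT) ?integral0//.
  - by apply/measurable_EFinP; exact: measurable_funX.
  - by move=> x _; rewrite lee_fin sqr_ge0.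
  - by apply: filterS PB0 => x -> _; rewrite expr0n.
by apply: filterS => x /eqP; rewrite subr_eq0 => /eqP.
Qed.

Lemma Cm1_image g : L2 mu g -> {ae mu, forall x, -1 <= g x} ->
  {ae mu, forall x, -1 <= complex.Re (f x) + P g x}.
Proof.
move=> Lg g1; have [/(_ (real_embed g))H _] := CV.
have /H[_] : Cm1 mu (real_embed g).
  by split; [exact: LCe|apply: filterS g1 => x].
by apply: filterS => x [_]; rewrite /aff_act ReD.
Qed.

Lemma Cm1_preimage g : L2 mu g -> {ae mu, forall x, -1 <= g x} ->
  exists k, [/\ L2 mu k, {ae mu, forall x, -1 <= k x} &
    {ae mu, forall x, complex.Re (f x) + P k x = g x}].
Proof.
move=> Lg g1; have [_ /(_ (real_embed g))H] := CV.
have /H[k [[[Lk1 Lk2] k1] fk]] : Cm1 mu (real_embed g).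
  by split; [exact: LCe|apply: filterS g1 => x].
exists (fun x => complex.Re (k x)); split=> //.
  by apply: filterS k1 => x [].
have kE : aeeq mu k (real_embed (fun x => complex.Re (k x))).
  rewrite /aeeq; apply: filterS k1 => x [k0 _].
  by apply/eqP; rewrite eq_complex /real_embed /= k0 !eqxx.
have := V_ae (conj Lk1 Lk2) (LCe Lk1) kE; rewrite /aeeq => Vk.
apply: filterS2 Vk fk => x; rewrite /aff_act /P /real_part_op => <- e.
by rewrite -ReD e.
Qed.

(* The cone of nonnegative functions is the recession cone of C_{-1} *)
Lemma real_part_ge0 g : L2 mu g ->
  {ae mu, forall x, 0 <= g x} <-> {ae mu, forall x, 0 <= P g x}.
Proof.
move=> Lg; have L0 := L2_0 (R := R) mu; split=> g0.
  have : {ae mu, forall x, forall n, -1 <= complex.Re (f x) + n%:R * P g x}.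
    apply: ae_foralln => n.
    have : {ae mu, forall x, -1 <= n%:R * g x}.
      by apply: filterS g0 => x gx; have := mulr_ge0 (ler0n R n) gx; lra.
    move/(Cm1_image (L2Z n%:R Lg)).
    by apply: filterS2 (P_Z n%:R Lg) => x ->.
  by apply: filterS => x; exact: recession_ge0.
(* f is the image of 0, which lies in C_{-1}. *)
have f1 : {ae mu, forall x, -1 <= complex.Re (f x)}.
  have : {ae mu, forall x : X, -1 <= 0 :> R} by apply: aeW => x; lra.
  move/(Cm1_image L0); have := P_B L0 L0.
  have -> : (fun _ : X => 0 - 0 : R) = fun=> 0 by apply/funext => y; rewrite subrr.
  by apply: filterS2 => x ->; rewrite subrr addr0.
have [[Lf _] _] := f_real.
have : {ae mu, forall x, forall n, -1 <= 0 + n%:R * g x}.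
  apply: ae_foralln => n.
  (* As P g >= 0, the function f + n P g lies in C_{-1}. Its preimage k satisfies P k = n P g, so n
     g = k >= -1 for every n. *)
  have LPn := L2_lin n%:R (real_part_L2 Lg) Lf.
  have : {ae mu, forall x, -1 <= n%:R * P g x + complex.Re (f x)}.
    apply: filterS2 f1 g0 => x fx gx.
    by have := mulr_ge0 (ler0n R n) gx; lra.
  move=> /(Cm1_preimage LPn)[k [Lk k1 fk]].
  have : {ae mu, forall x, P k x = P (fun y => n%:R * g y) x}.
    by apply: filterS2 fk (P_Z n%:R Lg) => x e ->; move: e; lra.
  move/(P_inj Lk (L2Z n%:R Lg)); apply: filterS2 k1 => x kx e.
  by rewrite add0r -e.
by apply: filterS => x; exact: recession_ge0.
Qed.

Lemma real_part_order_iso : order_iso mu P.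
Proof.
split.
- exact: real_part_L2.
- exact: real_part_lin.
- move=> g1 g2 L1 L2'; have [H1 H2] := real_part_ge0 (L2B L2' L1).
  split=> g12.
    have : {ae mu, forall x, 0 <= g2 x - g1 x} by apply: filterS g12 => x; rewrite subr_ge0.
    by move/H1; apply: filterS2 (P_B L2' L1) => x ->; rewrite subr_ge0.
  have : {ae mu, forall x, 0 <= P (fun y => g2 y - g1 y) x}.
    by apply: filterS2 (P_B L2' L1) g12 => x ->; rewrite subr_ge0.
  by move/H2; apply: filterS => x; rewrite subr_ge0.
- move=> g Lg; have [k [[Lk1 Lk2] Vk]] := V_surj (LCe Lg).
  exists (fun x => complex.Re (k x)) => //.
  (* Splitting k into real and imaginary parts shows that the real part of V k is P (Re k), because
     P takes real values. *)
  have kE : (fun x => 'i%C * real_embed (fun y => complex.Im (k y)) x +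
      real_embed (fun y => complex.Re (k y)) x) = k.
    apply/funext => x; rewrite /real_embed; case: (k x) => a b /=.
    by apply/eqP; rewrite eq_complex /=; apply/andP; split; apply/eqP; ring.
  have := V_lin 'i%C (LCe Lk2) (LCe Lk1); rewrite kE.
  rewrite /aeeq in Vk *; apply: filterS3 Vk (filterI (real_part_opE Lk1) (real_part_opE Lk2)).
  move=> x -> [-> ->] /(congr1 (@complex.Re R)).
  by rewrite ReD /real_embed /= !mul0r !mulr0 subrr add0r.
Qed.

Lemma Aff_preserving_spatial : standard_borel X R -> sigma_finite setT mu ->
  nonatomic mu -> mu setT <> 0%E ->
  exists (S Sinv : X -> X) (h : X -> R),
    Aut2 mu S Sinv h /\ aeeq mu f (sqrtS'm1 h) /\
    (forall g, L2C mu g -> aeeq mu (V g) (U_S Sinv h g)).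
Proof.
move=> sb sf na mu0.
have [S [Sinv [h [nsS RNh Ph]]]] :=
  isometric_spatial_realization sb sf na mu0 real_part_order_iso real_part_isometry.
have [mS mSinv SK SinvK nS] := nsS; have [mh h0 _] := RNh.
have ns_inv N : measurable N -> mu N = 0%E -> mu (Sinv @^-1` N) = 0%E.
  move=> mN N0; apply/nS; first exact: preimage_measurable.
  by rewrite (_ : _ @^-1` _ = N)//; apply/seteqP; split=> x /=; rewrite SK.
have [F FT mF] := sf.
have cover x : exists n, F n x.
  have : (\bigcup_n F n) x by rewrite -FT.
  by case=> n _; exists n.
have LF n : L2 mu (fun x => -1 * \1_(F n) x).
  by apply: L2Z; apply: L2_indic1; [exact: (mF n).1|exact: (mF n).2].
have F1 n : {ae mu, forall x, -1 <= -1 * \1_(F n) x :> R}.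
  by apply: aeW => x; rewrite indicE; case: (_ \in _); rewrite ?mulr1 ?mulr0// lerN10.
(* The constant -1 would be the least element of C_{-1} but need not be in L2; -1_F attains that
   value on F. Its image gives f - sqrt h >= -1 where Sinv x is in F. Its preimage k >= -1 gives -1
   = f + sqrt h (k o Sinv) >= f - sqrt h on F. *)
have f_ge : {ae mu, forall x, forall n,
    -1 <= complex.Re (f x) + Num.sqrt (h x) * (-1 * \1_(F n) (Sinv x))}.
  apply: ae_foralln => n.
  by apply: filterS2 (Cm1_image (LF n) (F1 n)) (Ph _ (LF n)) => x /[swap] ->.
have f_le : {ae mu, forall x, forall n,
    complex.Re (f x) <= -1 * \1_(F n) x + Num.sqrt (h x)}.
  apply: ae_foralln => n.
  have [k [Lk k1 fk]] := Cm1_preimage (LF n) (F1 n).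
  apply: filterS3 fk (Ph k Lk) (ae_comp mSinv ns_inv k1) => x <- -> kx.
  by have := sqrtr_ge0 (h x); nra.
have fE : {ae mu, forall x, complex.Re (f x) = Num.sqrt (h x) - 1}.
  apply: filterS2 f_ge f_le => x ge le; apply/le_anti/andP; split.
    by have [n Fn] := cover x; have := le n; rewrite indic_mem//; lra.
  by have [n Fn] := cover (Sinv x); have := ge n; rewrite indic_mem//; lra.
have [[Lf _] f0] := f_real.
exists S, Sinv, h; split; [split=> //|split].
(* Square integrability of sqrt h - 1 is inherited from f. *)
- apply: (ae_eq_L2 _ Lf fE); apply: measurable_funB => //.
  exact: (measurableT_comp (@measurable_sqrtr R)).
- rewrite /aeeq; apply: filterS2 fE f0 => x e1 e2.
  by apply/eqP; rewrite eq_complex /sqrtS'm1 /= e1 e2 !eqxx.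
move=> g [Lg1 Lg2].
have gE : (fun x => 'i%C * real_embed (fun y => complex.Im (g y)) x +
    real_embed (fun y => complex.Re (g y)) x) = g.
  apply/funext => x; rewrite /real_embed; case: (g x) => a b /=.
  by apply/eqP; rewrite eq_complex /=; apply/andP; split; apply/eqP; ring.
have := V_lin 'i%C (LCe Lg2) (LCe Lg1); rewrite gE /aeeq.
have := real_part_opE Lg1; have := real_part_opE Lg2; rewrite /aeeq => V2 V1.
apply: filterS3 (filterI V1 V2) (filterI (Ph _ Lg1) (Ph _ Lg2)).
move=> x [v1 v2] [p1 p2] ->; rewrite v1 v2 /real_embed p1 p2.
apply/eqP; rewrite eq_complex /U_S Re_scale Im_scale /=.
by apply/andP; split; apply/eqP; ring.
Qed.

End unitary_cone.

(** Almost everywhere statements hold trivially here, so the identity with density 1 serves. The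
    case is separate because the construction of a null copy starts from a set of positive
    measure. *)
Lemma null_measure_spatial (d : measure_display) (X : measurableType d) (R : realType)
    (mu : {measure set X -> \bar R}) (f : X -> R[i]) (V : (X -> R[i]) -> (X -> R[i])) :
  mu setT = 0%E ->
  exists (S Sinv : X -> X) (h : X -> R),
    Aut2 mu S Sinv h /\ aeeq mu f (sqrtS'm1 h) /\
    (forall g, L2C mu g -> aeeq mu (V g) (U_S Sinv h g)).
Proof.
move=> mu0; exists id, id, (cst 1); split; [split|split].
- by split.
- split=> // B mB; rewrite preimage_id -[RHS]mul1e.
  by rewrite -(integral_cst mu mB).
- rewrite (_ : (fun _ => _) = fun=> 0); first exact: L2_0.
  by apply/funext => x; rewrite /= sqrtr1 subrr.
- exact: measure0_ae.
- by move=> g _; exact: measure0_ae.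
Qed.

Theorem theorem4p1 (d : measure_display) (X : measurableType d) (R : realType)
    (mu : {measure set X -> \bar R}) :
  standard_borel X R -> sigma_finite setT mu -> nonatomic mu ->
  (forall (f : X -> R[i]) (V : (X -> R[i]) -> (X -> R[i])),
      Aff_R mu f V -> preserves_Cm1 mu f V ->
      exists (S Sinv : X -> X) (h : X -> R),
        Aut2 mu S Sinv h /\ aeeq mu f (sqrtS'm1 h) /\
        (forall g, L2C mu g -> aeeq mu (V g) (U_S Sinv h g))) /\
  (forall (S Sinv : X -> X) (h : X -> R),
      Aut2 mu S Sinv h ->
      Aff_R mu (sqrtS'm1 h) (U_S Sinv h) /\
      preserves_Cm1 mu (sqrtS'm1 h) (U_S Sinv h)).
Proof.
move=> sb sf na; split=> [f V fV CV|S Sinv h SA].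
  have [mu0|mu0] := pselect (mu setT = 0%E); first exact: null_measure_spatial.
  exact: Aff_preserving_spatial.
by split; [exact: Aut2_Aff SA|exact: Aut2_preserves SA].
Qed.
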